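(* Let $\Omega\subset\mathbb{R}^{2d}$ be compact with Lebesgue measure $|\Omega|>0$, and let $S$ be a positive trace class operator on $L^2(\mathbb{R}^d)$ with $\operatorname{tr}(S)=1$. Then $$\log|\Omega|+\frac{1}{|\Omega|}P(\chi_\Omega\star S)\;\le\;H_{vN}\!\left(\frac{\chi_\Omega}{|\Omega|}\star S\right),$$ where $P(\chi_\Omega\star S)=\operatorname{tr}(\chi_\Omega\star S)-\operatorname{tr}\big((\chi_\Omega\star S)^2\big)$ is the projection functional.
   Context: For $z=(x,\omega)\in\mathbb{R}^{2d}$, $\pi(z)$ is the unitary time-frequency shift on $L^2(\mathbb{R}^d)$, $\pi(z)f(t)=e^{2\pi i t\cdot\omega}f(t-x)$. For $f\in L^1(\mathbb{R}^{2d})$ and $S$ trace class, $f\star S=\int_{\mathbb{R}^{2d}} f(z)\,\pi(z)S\pi(z)^*\,dz$ (a trace class operator; Bochner or weak integral). $\chi_\Omega$ is the indicator function of $\Omega$. For a positive trace class operator $A$ with $\operatorname{tr}(A)=1$ and eigenvalues $(\mu_k)$ (with multiplicity), the von Neumann entropy is $H_{vN}(A)=-\operatorname{tr}(A\log A)=-\sum_k\mu_k\log\mu_k\in[0,\infty]$, with $0\log0=0$. *)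

(* Defs.v *)
From HB Require Import structures.
From mathcomp Require Import all_boot all_order all_algebra.
From mathcomp Require Import complex.
From mathcomp Require Import all_classical all_reals all_analysis.
Set Implicit Arguments.
Unset Strict Implicit.
Unset Printing Implicit Defensive.
Import Order.TTheory GRing.Theory Num.Theory.
Import numFieldNormedType.Exports.
Local Open Scope classical_set_scope.
Local Open Scope complex_scope.
Local Open Scope ring_scope.

(* R^n is 'rV[R]_n, with its library topology and the product (Borel)
   sigma-algebra generated by the coordinates. *)
Definition measure_rV_display : measure_display -> measure_display.
Proof. exact. Qed.

Section measurable_rV.
Context {dT : measure_display} {T : measurableType dT}.
Variable n : nat.

Let coors : 'I_n -> 'rV[T]_n -> T := fun i v => v ord0 i.

Let rV_set0 : g_sigma_preimage coors set0.
Proof. exact: sigma_algebra0. Qed.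

Let rV_setC A : g_sigma_preimage coors A -> g_sigma_preimage coors (~` A).
Proof. exact: sigma_algebraC. Qed.

Let rV_bigcup (F : _^nat) : (forall i, g_sigma_preimage coors (F i)) ->
  g_sigma_preimage coors (\bigcup_i (F i)).
Proof. exact: sigma_algebra_bigcup. Qed.

HB.instance Definition _ := @isMeasurable.Build (measure_rV_display dT)
  'rV[T]_n (g_sigma_preimage coors) rV_set0 rV_setC rV_bigcup.

End measurable_rV.

Lemma measurable_coord dT (T : measurableType dT) n (i : 'I_n) :
  measurable_fun [set: 'rV[T]_n] (fun v => v ord0 i).
Proof.
move=> _ Y mY; rewrite setTI; apply: sub_sigma_algebra => /=.
rewrite -bigcup_seq/=; exists i => /=; first by rewrite mem_index_enum.
by exists Y => //; rewrite setTI.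
Qed.

Lemma measurable_fun_rVP d1 dT (T1 : measurableType d1) (T : measurableType dT)
    n (f : T1 -> 'rV[T]_n) :
  (forall i, measurable_fun [set: T1] (fun x => f x ord0 i)) ->
  measurable_fun [set: T1] f.
Proof.
move=> mf _ A mA; rewrite setTI.
have : [set B | measurable (f @^-1` B)] A; last by [].
apply: mA; split => /=.
  split => /=; first by rewrite preimage_set0.
    by move=> B mB; rewrite setTD preimage_setC; exact: measurableC.
  by move=> F mF; rewrite preimage_bigcup; exact: bigcupT_measurable.
move=> B; rewrite -bigcup_seq/= => -[i _ [C mC <-]].
by rewrite setTI -[X in measurable X]setTI; exact: (mf i).
Qed.

Lemma sigma_finite_product d1 d2 (T1 : measurableType d1)
    (T2 : measurableType d2) (R : realType)
    (m1 : {sigma_finite_measure set T1 -> \bar R})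
    (m2 : {sigma_finite_measure set T2 -> \bar R}) :
  sigma_finite setT (m1 \x m2)%E.
Proof.
have /sigma_finiteP[F [TF ndF Foo]] := sigma_finiteT m1.
have /sigma_finiteP[G [TG ndG Goo]] := sigma_finiteT m2.
exists (fun n => F n `*` G n).
  rewrite -setXTT TF TG predeqE => -[x y]; split.
    move=> [/= [n _ Fnx] [k _ Gky]]; exists (maxn n k) => //; split.
    - by move: x Fnx; exact/subsetPset/ndF/leq_maxl.
    - by move: y Gky; exact/subsetPset/ndG/leq_maxr.
  by move=> [n _ []/= ? ?]; split; exists n.
move=> k; have [? ?] := Foo k; have [? ?] := Goo k.
split; first exact: measurableX.
by rewrite product_measure1E// lte_mul_pinfty// ge0_fin_numE.
Qed.

Section lebesgue_rV.
Variable R : realType.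

Definition rV_cons n (p : measurableTypeR R * 'rV[R]_n) : 'rV[R]_n.+1 :=
  row_mx (\row_(_ < 1) p.1) p.2.

Definition rV_uncons n (v : 'rV[R]_n.+1) : measurableTypeR R * 'rV[R]_n :=
  (v ord0 ord0, \row_i v ord0 (lift ord0 i)).

Lemma rV_cons0 n (p : measurableTypeR R * 'rV[R]_n) : rV_cons p ord0 ord0 = p.1.
Proof.
have -> : ord0 = lshift n ord0 :> 'I_(1 + n) by exact: val_inj.
by apply: etrans (row_mxEl _ _ _ _) _; rewrite mxE.
Qed.

Lemma rV_consS n (p : measurableTypeR R * 'rV[R]_n) i :
  rV_cons p ord0 (lift ord0 i) = p.2 ord0 i.
Proof.
have -> : lift ord0 i = rshift 1 i :> 'I_(1 + n) by exact: val_inj.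
exact: row_mxEr.
Qed.

Lemma rV_consK n : cancel (@rV_cons n) (@rV_uncons n).
Proof.
move=> [x v]; rewrite /rV_uncons rV_cons0; congr pair.
by apply/rowP => i; rewrite mxE rV_consS.
Qed.

Lemma rV_unconsK n : cancel (@rV_uncons n) (@rV_cons n).
Proof.
move=> v; apply/rowP => i; case: (unliftP ord0 i) => [j ->|->].
  by rewrite rV_consS mxE.
by rewrite rV_cons0.
Qed.

Lemma measurable_rV_cons n : measurable_fun setT (@rV_cons n).
Proof.
apply: measurable_fun_rVP => i; case: (unliftP ord0 i) => [j ->|->].
  under eq_fun do rewrite rV_consS.
  exact: (measurableT_comp (measurable_coord j) measurable_snd).
by under eq_fun do rewrite rV_cons0; exact: measurable_fst.
Qed.

Lemma measurable_rV_uncons n : measurable_fun setT (@rV_uncons n).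
Proof.
apply: measurable_fun_pair; first exact: measurable_coord.
apply: measurable_fun_rVP => i.
by under eq_fun do rewrite mxE; exact: measurable_coord.
Qed.

Section step.
Variables (n : nat) (mu : {sigma_finite_measure set 'rV[R]_n -> \bar R}).

Definition lebesgue_step : set 'rV[R]_n.+1 -> \bar R :=
  pushforward (@lebesgue_measure R \x mu)%E (@rV_cons n).

Let lebesgue_step0 : lebesgue_step set0 = 0%E.
Proof. by rewrite /lebesgue_step /pushforward preimage_set0 measure0. Qed.

Let lebesgue_step_ge0 A : (0 <= lebesgue_step A)%E.
Proof. exact: (measure_ge0 (@lebesgue_measure R \x mu)%E). Qed.

Let lebesgue_step_sigma_additive : semi_sigma_additive lebesgue_step.
Proof.
move=> F mF tF mUF; rewrite /lebesgue_step /pushforward preimage_bigcup.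
apply: measure_semi_sigma_additive.
- by move=> k; rewrite -[X in measurable X]setTI; exact: measurable_rV_cons.
- apply/trivIsetP => /= i j _ _ ij; rewrite -preimage_setI.
  by move/trivIsetP : tF => /(_ _ _ _ _ ij) ->//; rewrite preimage_set0.
- rewrite -preimage_bigcup -[X in measurable X]setTI.
  exact: measurable_rV_cons.
Qed.

HB.instance Definition _ := isMeasure.Build _ _ _ lebesgue_step
  lebesgue_step0 lebesgue_step_ge0 lebesgue_step_sigma_additive.

Let lebesgue_step_sigma_finite : sigma_finite setT lebesgue_step.
Proof.
have [F FT Foo] := sigma_finite_product (@lebesgue_measure R) mu.
exists (fun k => @rV_uncons n @^-1` F k).
  by rewrite -preimage_bigcup -FT preimage_setT.
move=> k; have [mF Fk] := Foo k; split.
  by rewrite -[X in measurable X]setTI; exact: measurable_rV_uncons.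
rewrite /lebesgue_step /pushforward -comp_preimage.
rewrite (_ : _ \o _ = id) ?preimage_id//.
by apply/funext => p; exact: rV_consK.
Qed.

HB.instance Definition _ := Measure_isSigmaFinite.Build _ _ _ lebesgue_step
  lebesgue_step_sigma_finite.

End step.

(* Lebesgue measure on R^n, as an n-fold product; see lebesgue_rV_box. *)
Fixpoint lebesgue_rV n : {sigma_finite_measure set 'rV[R]_n -> \bar R} :=
  match n with
  | 0%N => \d_(0 : 'rV[R]_0)
  | m.+1 => lebesgue_step (lebesgue_rV m)
  end.

Lemma lebesgue_rV_box n (A : 'I_n -> set R) :
  (forall i, measurable (A i)) ->
  lebesgue_rV n [set v | forall i, A i (v ord0 i)] =
    (\prod_(i < n) lebesgue_measure (A i))%E.
Proof.
elim: n A => [|n IHn] A mA /=.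
  rewrite big_ord0 diracE mem_set//; by case.
pose B : set 'rV[R]_n := [set v | forall i, A (lift ord0 i) (v ord0 i)].
have mB : measurable B.
  rewrite (_ : B = \bigcap_(i in [set: 'I_n])
      ((fun v : 'rV[R]_n => v ord0 i) @^-1` A (lift ord0 i))).
    apply: fin_bigcap_measurable => // i _.
    rewrite -[X in measurable X]setTI.
    exact: (measurable_coord i measurableT (mA _)).
  by apply/seteqP; split=> v /= Bv i; [move=> _|]; exact: Bv.
rewrite big_ord_recl -(IHn (fun i => A (lift ord0 i)))//.
rewrite -(product_measure1E (@lebesgue_measure R) (lebesgue_rV n))//;
  last exact: mA.
rewrite /lebesgue_step /pushforward; congr (_ _); apply/seteqP; split.
  move=> p /= Ap; split => [|i]; first by have := Ap ord0; rewrite rV_cons0.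
  by have := Ap (lift ord0 i); rewrite rV_consS.
move=> p [/= A0 AS] i; case: (unliftP ord0 i) => [j ->|->].
  by rewrite rV_consS; exact: AS.
by rewrite rV_cons0.
Qed.

End lebesgue_rV.

Section L2.
Variables (R : realType) (d : nat).
Local Notation C := R[i].
Local Notation Rd := 'rV[R]_d.
Local Notation mu := (lebesgue_rV R d).

Definition Cintegral disp (T : measurableType disp)
    (m : {measure set T -> \bar R}) (f : T -> C) : C :=
  (\int[m]_x complex.Re (f x)) +i* (\int[m]_x complex.Im (f x)).

(* Elements of L^2(R^d) are represented by square-integrable functions, and
   equality in L^2(R^d) is almost everywhere equality [eqL2]. *)
Definition L2 : set (Rd -> C) :=
  [set f | (fun t => complex.Re (f t)) \in Lfun mu 2%:E /\
           (fun t => complex.Im (f t)) \in Lfun mu 2%:E].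

Definition eqL2 (f g : Rd -> C) : Prop := ae_eq mu setT f g.

Definition inner (f g : Rd -> C) : C :=
  Cintegral mu (fun t => f t * (g t)^*).

Definition normL2 (f : Rd -> C) : R := Num.sqrt (complex.Re (inner f f)).

(* Operators act on representatives; only their values on L2, up to eqL2,
   are meaningful. *)
Definition operator := (Rd -> C) -> (Rd -> C).

(* Bounded linear operator on L^2(R^d). Linearity up to eqL2 together with the
   norm bound forces T f and T g to be eqL2 whenever f and g are. *)
Definition bounded_operator (T : operator) : Prop :=
  [/\ forall f, L2 f -> L2 (T f),
      forall (a : C) f g, L2 f -> L2 g ->
        eqL2 (T (fun t => a * f t + g t)) (fun t => a * T f t + T g t)
    & exists M : R, forall f, L2 f -> normL2 (T f) <= M * normL2 f].

(* For z : C, 0 <= z in R[i] means that z is real and nonnegative. *)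
Definition positive_operator (T : operator) : Prop :=
  forall f, L2 f -> 0 <= inner (T f) f.

Definition is_adjoint (T T' : operator) : Prop :=
  bounded_operator T' /\
  forall f g, L2 f -> L2 g -> inner (T f) g = inner f (T' g).

Definition adjoint (T : operator) : operator :=
  xget (fun _ => cst 0) [set T' | is_adjoint T T'].

(* L^2(R^d) is separable, and infinite-dimensional for 0 < d, so its
   orthonormal bases are indexed by nat. *)
Definition orthonormal_basis (e : nat -> Rd -> C) : Prop :=
  [/\ forall n, L2 (e n),
      forall m n, inner (e m) (e n) = (m == n)%:R
    & forall f, L2 f -> (forall n, inner f (e n) = 0) -> eqL2 f (cst 0)].

(* A = |T|, the positive square root of T^* T *)
Definition is_absolute_value (T A : operator) : Prop :=
  [/\ bounded_operator A, positive_operator A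
    & forall f, L2 f -> eqL2 (A (A f)) (adjoint T (T f))].

Definition trace_class (T : operator) : Prop :=
  bounded_operator T /\
  exists A e, [/\ is_absolute_value T A, orthonormal_basis e
    & (\sum_(0 <= n <oo) (complex.Re (inner (A (e n)) (e n)))%:E < +oo)%E].

Definition std_basis : nat -> Rd -> C :=
  xget (fun _ => cst 0) [set e | orthonormal_basis e].

(* For trace class T the series converges absolutely and its sum does not
   depend on the orthonormal basis; a basis is therefore fixed by choice. *)
Definition trace (T : operator) : C :=
  let t n := inner (T (std_basis n)) (std_basis n) in
  limn (series (fun n => complex.Re (t n))) +i*
  limn (series (fun n => complex.Im (t n))).

(* pi(x, w) f (t) = exp(2 i pi (t . w)) f (t - x) *)
Definition tf_shift (z : Rd * Rd) : operator := fun f t =>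
  let theta := 2 * pi * \sum_(i < d) t ord0 i * z.2 ord0 i in
  (cos theta +i* sin theta) * f (t - z.1).

Definition phase_lebesgue : {measure set (Rd * Rd) -> \bar R} := (mu \x mu)%E.

(* T is the weak integral of f(z) pi(z) S pi(z)^* over R^2d. *)
Definition is_op_conv (f : Rd * Rd -> C) (S T : operator) : Prop :=
  bounded_operator T /\
  forall g h, L2 g -> L2 h ->
    inner (T g) h = Cintegral phase_lebesgue
      (fun z => f z * inner (tf_shift z (S (adjoint (tf_shift z) g))) h).

Definition op_conv (f : Rd * Rd -> C) (S : operator) : operator :=
  xget (fun _ => cst 0) [set T | is_op_conv f S T].

(* Both traces are real when T is positive. *)
Definition projection_functional (T : operator) : R :=
  complex.Re (trace T - trace (T \o T)).

Definition lin_indep n (v : 'I_n -> Rd -> C) : Prop :=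
  forall c : 'I_n -> C,
    eqL2 (fun t => \sum_(i < n) c i * v i t) (cst 0) -> forall i, c i = 0.

Definition eigenspace (T : operator) (l : R) : set (Rd -> C) :=
  [set f | L2 f /\ eqL2 (T f) (fun t => l%:C * f t)].

(* dimension of the eigenspace, possibly +oo; it is 0 when l is not an
   eigenvalue *)
Definition multiplicity (T : operator) (l : R) : \bar R :=
  ereal_sup [set n%:R%:E | n in [set n : nat |
    exists2 v : 'I_n -> Rd -> C,
      forall i, eigenspace T l (v i) & lin_indep v]].

(* The sum of - mu_k log mu_k over the eigenvalues counted with multiplicity,
   for T positive, trace class and of trace 1; its eigenvalues are then in
   [0, 1], so the terms are nonnegative. The library's ln 0 = 0 and
   +oo * 0 = 0 make the eigenvalue 0 contribute 0, whatever its multiplicity. *)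
Definition vN_entropy (T : operator) : \bar R :=
  \esum_(l in [set: R]) (multiplicity T l * (- (l * ln l))%:E)%E.

End L2.

(* Main.v *)
(* Write A for the operator [op_conv (1_Omega / |Omega|) S] and s_j for its
   eigenvalues. Since -log x >= 1 - x,
     - s log s >= (log |Omega|) s + s - |Omega| s^2   for s >= 0,
   and the theorem follows by summation from sum_j s_j = tr A = 1 and
   sum_j s_j^2 <= tr A^2 (Bessel).
   The trace of A is computed by exchanging the sum over a basis (e_k) with the
   integral over Omega: for each z the vectors pi(z)^* e_k satisfy Parseval's
   identity because pi(z) is an isometry, and sum_k <S f_k, f_k> is the same for
   all families (f_k) satisfying Parseval's identity.
   The eigenvectors of a positive operator with summable diagonal come from a
   power iteration: if 0 <= K <= 1 then K^k v converges, its limit is fixed by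
   K, and summability of the diagonal prevents all these limits from vanishing
   when K has norm 1. Deflation then yields all eigenvectors. *)
Require Import Defs.
From HB Require Import structures.
From mathcomp Require Import all_boot all_order all_algebra.
From mathcomp Require Import complex finmap.
From mathcomp Require Import all_classical all_reals all_analysis.
From mathcomp Require Import measurable_realfun.
From mathcomp Require Import zify ring lra.
Set Implicit Arguments.
Unset Strict Implicit.
Unset Printing Implicit Defensive.
Import Order.TTheory GRing.Theory Num.Theory.
Import numFieldNormedType.Exports.
Local Open Scope classical_set_scope.
Local Open Scope complex_scope.
Local Open Scope ring_scope.

(** * Semi-inner product spaces *)

(** With A as above, the convolution of S with 1_Omega is |Omega| A, so P / |Omega| = 1 - |Omega| tr
    A^2 and the left-hand side is log |Omega| + 1 - |Omega| tr A^2: exactly the sum over j of the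
    scalar lower bounds. Two features of the definitions shape the development. Vectors are
    functions, equal only almost everywhere, so identities between vectors are tested against [ip],
    and operators are linear only in that sense. Moreover [adjoint] and [op_conv] are picked by
    choice, so nothing is known of them until some operator with the defining property is exhibited;
    a Riesz theorem relative to an orthonormal basis produces such operators from bounded
    sesquilinear forms, and for the convolution the form is an integral whose measurability has to
    be established without a formula for the adjoint of pi(z). The entropy is a sum over all reals
    of suprema. It is bounded below by finite subsums, in which finitely many orthonormal
    eigenvectors bound each multiplicity from below. *)

Section complex_parts.
Variable R : realType.
Implicit Types (a b : R) (z w : R[i]).
Local Notation Re := complex.Re.
Local Notation Im := complex.Im.

Lemma complexP z w : Re z = Re w -> Im z = Im w -> z = w.
Proof. by case: z w => [? ?] [? ?] /= -> ->. Qed.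

Lemma cReM z w : Re (z * w) = Re z * Re w - Im z * Im w.
Proof. by case: z w => [? ?] [? ?]. Qed.

Lemma cImM z w : Im (z * w) = Re z * Im w + Im z * Re w.
Proof. by case: z w => [? ?] [? ?]. Qed.

Lemma cReD z w : Re (z + w) = Re z + Re w.
Proof. by case: z w => [? ?] [? ?]. Qed.

Lemma cImD z w : Im (z + w) = Im z + Im w.
Proof. by case: z w => [? ?] [? ?]. Qed.

Lemma cReN z : Re (- z) = - Re z. Proof. by case: z. Qed.
Lemma cImN z : Im (- z) = - Im z. Proof. by case: z. Qed.
Lemma cReJ z : Re (z^*) = Re z. Proof. by case: z. Qed.
Lemma cImJ z : Im (z^*) = - Im z. Proof. by case: z. Qed.
Lemma cReC a : Re a%:C = a. Proof. by []. Qed.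
Lemma cImC a : Im a%:C = 0. Proof. by []. Qed.
Lemma ReP a b : Re (a +i* b) = a. Proof. by []. Qed.
Lemma ImP a b : Im (a +i* b) = b. Proof. by []. Qed.
Lemma cRe0 : Re (0 : R[i]) = 0. Proof. by []. Qed.
Lemma cIm0 : Im (0 : R[i]) = 0. Proof. by []. Qed.
Lemma cRe1 : Re (1 : R[i]) = 1. Proof. by []. Qed.
Lemma cIm1 : Im (1 : R[i]) = 0. Proof. by []. Qed.

(* [ReP] and [ImP] are left out: up to conversion they would match, and unfold,
   the parts of an inner product of functions. *)
Definition partsE := (cReM, cImM, cReD, cImD, cReN, cImN, cReJ, cImJ,
  cReC, cImC, cRe0, cIm0, cRe1, cIm1).

Lemma Re_sum I (r : seq I) (P : pred I) (F : I -> R[i]) :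
  Re (\sum_(i <- r | P i) F i) = \sum_(i <- r | P i) Re (F i).
Proof. by elim/big_rec2: _ => // i x y _ <-; rewrite cReD. Qed.

Lemma Im_sum I (r : seq I) (P : pred I) (F : I -> R[i]) :
  Im (\sum_(i <- r | P i) F i) = \sum_(i <- r | P i) Im (F i).
Proof. by elim/big_rec2: _ => // i x y _ <-; rewrite cImD. Qed.

Lemma complex_ge0 z : 0 <= z -> 0 <= Re z /\ Im z = 0.
Proof. by rewrite lecE /= => /andP[/eqP-> ->]. Qed.

Definition sqn z : R := Re z ^+ 2 + Im z ^+ 2.

Lemma sqn_ge0 z : 0 <= sqn z.
Proof. by rewrite addr_ge0// sqr_ge0. Qed.

Lemma sqnM z w : sqn (z * w) = sqn z * sqn w.
Proof. by rewrite /sqn !partsE; ring. Qed.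

Lemma sqnJ z : sqn (z^*) = sqn z.
Proof. by rewrite /sqn !partsE; ring. Qed.

Lemma sqnN z : sqn (- z) = sqn z.
Proof. by rewrite /sqn !partsE; ring. Qed.

Lemma sqnC a : sqn a%:C = a ^+ 2.
Proof. by rewrite /sqn !partsE; ring. Qed.

Lemma sqn0 : sqn 0 = 0.
Proof. by rewrite /sqn !partsE; ring. Qed.

Lemma sqn_eq0 z : sqn z = 0 -> z = 0.
Proof.
move/eqP; rewrite paddr_eq0 ?sqr_ge0// !sqrf_eq0 => /andP[/eqP ? /eqP ?].
exact: complexP.
Qed.

Lemma sqnD_le z w : sqn (z + w) <= 2 * sqn z + 2 * sqn w.
Proof.
rewrite /sqn !partsE.
have := sqr_ge0 (Re z - Re w); have := sqr_ge0 (Im z - Im w).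
by rewrite !expr2; lra.
Qed.

Lemma mulC_sqn z : z * z^* = (sqn z)%:C.
Proof. by apply: complexP; rewrite /sqn !partsE; ring. Qed.

Lemma Re_sqr_le z : Re z ^+ 2 <= sqn z.
Proof. by rewrite lerDl sqr_ge0. Qed.

Lemma Im_sqr_le z : Im z ^+ 2 <= sqn z.
Proof. by rewrite lerDr sqr_ge0. Qed.

End complex_parts.

(* Only a semi-inner product: vectors at distance 0 need not be equal, so that
   functions can be used as elements of L^2 without passing to a quotient.
   Equality of vectors is always tested against [ip]. *)
Record semi_inner_product (R : realType) (V : lmodType R[i])
    (b : V -> V -> R[i]) : Prop := SemiInnerProduct {
  sip_linear : forall a u v w, b (a *: u + v) w = a * b u w + b v w;
  sip_conj : forall u v, b v u = (b u v)^*;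
  sip_ge0 : forall u, 0 <= complex.Re (b u u) }.

Section semi_inner_product.
Variables (R : realType) (V : lmodType R[i]) (b : V -> V -> R[i]).
Hypothesis bS : semi_inner_product b.
Local Notation Re := complex.Re.
Local Notation Im := complex.Im.

Lemma sipDl u v w : b (u + v) w = b u w + b v w.
Proof. by rewrite -[u]scale1r (sip_linear bS) mul1r scale1r. Qed.

Lemma sip0l w : b 0 w = 0.
Proof. by apply: (addrI (b 0 w)); rewrite -sipDl !addr0. Qed.

Lemma sipZl a u w : b (a *: u) w = a * b u w.
Proof. by rewrite -[a *: u]addr0 (sip_linear bS) sip0l addr0. Qed.

Lemma sipNl u w : b (- u) w = - b u w.
Proof. by rewrite -scaleN1r sipZl mulN1r. Qed.

Lemma sipBl u v w : b (u - v) w = b u w - b v w.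
Proof. by rewrite sipDl sipNl. Qed.

Lemma sip_suml I (r : seq I) (P : pred I) (F : I -> V) w :
  b (\sum_(i <- r | P i) F i) w = \sum_(i <- r | P i) b (F i) w.
Proof. by elim/big_rec2: _ => [|i x y _ <-]; rewrite ?sip0l ?sipDl. Qed.

Lemma sipDr u v w : b w (u + v) = b w u + b w v.
Proof. by rewrite (sip_conj bS) sipDl rmorphD/= -!(sip_conj bS). Qed.

Lemma sip0r w : b w 0 = 0.
Proof. by rewrite (sip_conj bS) sip0l rmorph0. Qed.

Lemma sipZr a u w : b w (a *: u) = a^* * b w u.
Proof. by rewrite (sip_conj bS) sipZl rmorphM/= -(sip_conj bS). Qed.

Lemma sipNr u w : b w (- u) = - b w u.
Proof. by rewrite -scaleN1r sipZr rmorphN rmorph1 mulN1r. Qed.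

Lemma sipBr u v w : b w (u - v) = b w u - b w v.
Proof. by rewrite sipDr sipNr. Qed.

Lemma sip_sumr I (r : seq I) (P : pred I) (F : I -> V) w :
  b w (\sum_(i <- r | P i) F i) = \sum_(i <- r | P i) b w (F i).
Proof. by elim/big_rec2: _ => [|i x y _ <-]; rewrite ?sip0r ?sipDr. Qed.

Definition sipE := (sipDl, sipDr, sipNl, sipNr, sipZl, sipZr, sip0l, sip0r).

Lemma Im_sip u : Im (b u u) = 0.
Proof. by have /(congr1 (@complex.Im R)) := sip_conj bS u u; rewrite cImJ; lra. Qed.

Lemma sip_diag u : b u u = (Re (b u u))%:C.
Proof. by apply: complexP => //=; rewrite Im_sip. Qed.

(** Expand the form at [u - t z v] with [z = b u v] and [t] real, which gives a real quadratic
    polynomial in [t] although [z] is complex. *)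
Lemma sip_CauchySchwarz u v : sqn (b u v) <= Re (b u u) * Re (b v v).
Proof.
set z := b u v; set x := Re _; set y := Re _.
have quad (t : R) : 0 <= x - 2 * t * sqn z + t ^+ 2 * sqn z * y.
  have := sip_ge0 bS (u - (t%:C * z) *: v).
  rewrite !sipE (sip_conj bS u v) (sip_diag u) (sip_diag v) -/x -/y -/z.
  by rewrite !partsE /sqn; congr (0 <= _); ring.
have x0 : 0 <= x := sip_ge0 bS u.
have y0 : 0 <= y := sip_ge0 bS v.
have z0 := sqn_ge0 z.
have [zz|zz] := eqVneq (sqn z) 0; first by rewrite zz mulr_ge0.
have [yy|yy] := eqVneq y 0.
  (* For [y = 0] the polynomial is affine with nonzero slope; this [t] makes it equal to -1. *)
  have := quad ((x + 1) / (2 * sqn z)).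
  rewrite yy mulr0 addr0 (_ : 2 * _ * _ = x + 1); last by field.
  lra.
(* The minimum of the polynomial is at [t = 1 / y]. *)
have := quad y^-1.
rewrite (_ : _ + _ = (x * y - sqn z) / y); last by field.
by rewrite pmulr_lge0 ?invr_gt0 ?lt_def ?yy// subr_ge0.
Qed.

Lemma sip_null u v : Re (b u u) = 0 -> b u v = 0.
Proof.
move=> u0; apply: sqn_eq0; apply/eqP; rewrite eq_le sqn_ge0 andbT.
by have := sip_CauchySchwarz u v; rewrite u0 mul0r.
Qed.

(** The parallelogram law with one square dropped. It replaces the triangle inequality, so that
    squared norms can be used throughout. *)
Lemma normD_le u v :
  Re (b (u + v) (u + v)) <= 2 * Re (b u u) + 2 * Re (b v v).
Proof.
have := sip_ge0 bS (u - v); rewrite !sipE !partsE (sip_conj bS u v) cReJ; lra.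
Qed.

End semi_inner_product.

(** * Convergence of real sequences and partial sums *)

Section real_sequences.
Variable R : realType.
Implicit Types (u v : nat -> R) (l m : R).

Lemma cvgn0_le u v : (forall n, 0 <= u n <= v n) ->
  v n @[n --> \oo] --> 0 -> u n @[n --> \oo] --> 0.
Proof.
move=> uv v0; apply: (@squeeze_cvgr _ _ _ _ (cst 0) v) => //.
- exact: nearW.
- exact: cvg_cst.
Qed.

Lemma cvgn_le_cst u l m : (forall n, u n <= m) ->
  u n @[n --> \oo] --> l -> l <= m.
Proof.
move=> um ul; rewrite -(cvg_lim _ ul)//; apply: limr_le.
  by apply/cvg_ex; exists l.
exact: nearW.
Qed.

Lemma cvgn_ge_cst u l m : (forall n, m <= u n) ->
  u n @[n --> \oo] --> l -> m <= l.
Proof.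
move=> um ul; rewrite -(cvg_lim _ ul)//; apply: limr_ge.
  by apply/cvg_ex; exists l.
exact: nearW.
Qed.

Lemma cvgn_eps u l : u n @[n --> \oo] --> l ->
  forall eps, 0 < eps ->
  exists n0, forall n, (n0 <= n)%N -> l - eps < u n < l + eps.
Proof.
move=> /cvgrPdist_lt + eps e0 => /(_ _ e0)[n0 _ h]; exists n0 => n /h /=.
by rewrite ltr_norml => /andP[? ?]; apply/andP; split; lra.
Qed.

Lemma nondecreasing_cvgn_bounded u m : {homo u : i j / (i <= j)%N >-> i <= j} ->
  (forall n, u n <= m) -> exists2 l, u n @[n --> \oo] --> l & forall n, u n <= l.
Proof.
move=> nd um; have cu : cvgn u.
  by apply: nondecreasing_is_cvgn => //; exists m => _ [n _ <-].
by exists (limn u) => // n; exact: nondecreasing_cvgn_le.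
Qed.

Lemma nonincreasing_cvgn_bounded u m : {homo u : i j / (i <= j)%N >-> i >= j} ->
  (forall n, m <= u n) -> exists2 l, u n @[n --> \oo] --> l & forall n, l <= u n.
Proof.
move=> nd um; have cu : cvgn u.
  by apply: nonincreasing_is_cvgn => //; exists m => _ [n _ <-].
by exists (limn u) => // n; exact: nonincreasing_cvgn_ge.
Qed.

Lemma nondecreasing_psum u : (forall n, 0 <= u n) ->
  {homo (fun n => \sum_(i < n) u i) : i j / (i <= j)%N >-> i <= j}.
Proof.
move=> u0; apply: homo_leq => [//|x y z|n]; first exact: le_trans.
by rewrite big_ord_recr/= lerDl.
Qed.

Lemma psum_cvgn0 u l : \sum_(i < n) u i @[n --> \oo] --> l -> u n @[n --> \oo] --> 0.
Proof.
move=> ul.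
have -> : u = (fun n => \sum_(i < n.+1) u i - \sum_(i < n) u i).
  by apply/funext => n; rewrite big_ord_recr/= [X in X - _]addrC addrK.
rewrite -[X in _ --> X](subrr l); apply: cvgB => //.
by rewrite (cvg_shiftS (fun n => \sum_(i < n) u i)).
Qed.

Lemma cvgn_sum (f : nat -> nat -> R) (l : nat -> R) n :
  (forall i, f i k @[k --> \oo] --> l i) ->
  \sum_(i < n) f i k @[k --> \oo] --> \sum_(i < n) l i.
Proof.
move=> fl; elim: n => [|n IH].
  by under eq_fun do rewrite big_ord0; rewrite big_ord0; exact: cvg_cst.
by under eq_fun do rewrite big_ord_recr/=; rewrite big_ord_recr/=; exact: cvgD.
Qed.

End real_sequences.

(** * Orthonormal bases, Parseval's identity and Riesz representation *)

Record hilbert (R : realType) := Hilbert {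
  hilbert_sort :> lmodType R[i];
  ip : hilbert_sort -> hilbert_sort -> R[i];
  ip_sip : semi_inner_product ip;
  ip_complete : forall u : nat -> hilbert_sort,
    (forall eps : R, 0 < eps -> exists n0, forall m n, (n0 <= n)%N ->
       (n <= m)%N -> complex.Re (ip (u m - u n) (u m - u n)) <= eps) ->
    exists w, complex.Re (ip (u n - w) (u n - w)) @[n --> \oo] --> 0 }.

Section hilbert_theory.
Variables (R : realType) (H : hilbert R).
Local Notation Re := complex.Re.
Local Notation Im := complex.Im.
Local Notation sip := (ip_sip H).
Implicit Types (u v w : H) (e : nat -> H) (c : nat -> R[i]).

Definition nsq u : R := Re (ip u u).

Lemma nsq_ge0 u : 0 <= nsq u. Proof. exact: (sip_ge0 sip). Qed.

Lemma nsqD_le u v : nsq (u + v) <= 2 * nsq u + 2 * nsq v.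
Proof. exact: (normD_le sip). Qed.

Lemma nsqZ a u : nsq (a *: u) = sqn a * nsq u.
Proof.
rewrite /nsq !(sipE sip) (sip_diag sip) !partsE /sqn; ring.
Qed.

Lemma nsq_scaled (a : R) u v : (forall w, ip u w = a%:C * ip v w) ->
  nsq u = a ^+ 2 * nsq v.
Proof.
move=> uv; rewrite /nsq uv (sip_conj sip u) uv (sip_diag sip) !partsE; ring.
Qed.

Lemma ip_le u v : sqn (ip u v) <= nsq u * nsq v.
Proof. exact: (sip_CauchySchwarz sip). Qed.

Lemma sqn_ipC u v : sqn (ip u v) = sqn (ip v u).
Proof. by rewrite (sip_conj sip) sqnJ. Qed.

Definition norm_lim e w := nsq (e n - w) @[n --> \oo] --> 0.

(** By Cauchy-Schwarz, |<w, v> - z|^2 is at most |e_n - w|^2 |v|^2 for large n. An eventually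
    constant value is all that occurs: the coefficients of the partial sums of an expansion
    stabilize. *)
Lemma norm_lim_ip e w v (z : R[i]) : norm_lim e w ->
  (\forall n \near \oo, ip (e n) v = z) -> ip w v = z.
Proof.
move=> ew ez; apply/esym/subr0_eq/sqn_eq0; apply/eqP.
rewrite eq_le sqn_ge0 andbT.
have h : nsq (e n - w) * nsq v @[n --> \oo] --> 0 * nsq v.
  by apply: cvgM => //; exact: cvg_cst.
rewrite mul0r in h; rewrite -(cvg_lim _ h)//; apply: limr_ge.
  by apply/cvg_ex; exists 0.
near=> n; rewrite -(_ : ip (e n) v = z); last by near: n.
by rewrite -(sipBl sip) ip_le.
Unshelve. all: by end_near. Qed.

(** Norms are only bounded by 1 so that zero vectors are allowed: the eigenvectors of an operator of
    finite rank are padded with zeros, and Bessel's inequality still holds. *)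
Definition orthofamily (phi : nat -> H) :=
  (forall i j, i <> j -> ip (phi i) (phi j) = 0) /\
  (forall i, nsq (phi i) <= 1).

(** Completeness concludes [nsq u = 0] instead of [u = 0] because null vectors are not identified
    with 0. Separability of [H] enters through the existence of such a family. *)
Definition onb e := (forall i j, ip (e i) (e j) = (i == j)%:R) /\
  (forall u, (forall n, ip u (e n) = 0) -> nsq u = 0).

Lemma onb_orthofamily e : onb e -> orthofamily e.
Proof.
move=> [eo _]; split=> [i j /eqP/negPf ij|i]; first by rewrite eo ij.
by rewrite /nsq eo eqxx.
Qed.

Lemma onb_nsq e i : onb e -> nsq (e i) = 1.
Proof. by move=> [eo _]; rewrite /nsq eo eqxx. Qed.

Definition proj e n u := \sum_(i < n) ip u (e i) *: e i.

Lemma nsq_comb (phi : nat -> H) c n : orthofamily phi ->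
  nsq (\sum_(i < n) c i *: phi i) = \sum_(i < n) sqn (c i) * nsq (phi i).
Proof.
move=> [po _]; elim: n => [|n IH]; first by rewrite !big_ord0 /nsq (sip0l sip).
rewrite !big_ord_recr/= -IH -nsqZ /nsq (sipDl sip) !(sipDr sip).
set s := \sum_(i < n) _.
have s0 : ip s (phi n) = 0.
  rewrite (sip_suml sip) big1// => i _; rewrite (sipZl sip) po ?mulr0//.
  by move=> /eqP; rewrite ltn_eqF.
rewrite (sip_conj sip s (_ *: _)) (sipZr sip _ _ s) s0 mulr0 rmorph0 addr0 add0r.
by rewrite cReD.
Qed.

Lemma ip_comb (phi : nat -> H) c n k : orthofamily phi ->
  ip (\sum_(i < n) c i *: phi i) (phi k) =
  if (k < n)%N then c k * (nsq (phi k))%:C else 0.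
Proof.
move=> [po _]; rewrite (sip_suml sip).
under eq_bigr do rewrite (sipZl sip).
case: ltnP => kn.
  rewrite (bigD1 (Ordinal kn))//= big1 ?addr0; first by rewrite (sip_diag sip).
  move=> i.
  by move/eqP => ik; rewrite po ?mulr0// => h; apply: ik; exact: val_inj.
rewrite big1// => i _; rewrite po ?mulr0// => ik; move: (ltn_ord i).
by rewrite ik ltnNge kn.
Qed.

(** Expand |u - p|^2 for the partial expansion p, where <u, p> is the sum on the left and |p|^2 is
    at most that sum, the vectors having norm at most 1. *)
Lemma bessel (phi : nat -> H) n u : orthofamily phi ->
  \sum_(i < n) sqn (ip u (phi i)) <= nsq u.
Proof.
move=> phio; have [_ phi1] := phio.
set s := \sum_(i < n) sqn _; set p := proj phi n u.
have pp : nsq p <= s.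
  rewrite /p /proj (nsq_comb (fun i => ip u (phi i)))//.
  by apply: ler_sum => i _; rewrite ler_piMr ?sqn_ge0.
have up : Re (ip u p) = s.
  rewrite (sip_sumr sip) Re_sum; apply: eq_bigr => i _.
  by rewrite (sipZr sip) mulrC mulC_sqn.
have := nsq_ge0 (u - p); rewrite /nsq !(sipE sip) (sip_conj sip u p) !partsE.
by rewrite up -/(nsq p) -/(nsq u); lra.
Qed.

(** Riesz-Fischer: squared distances of partial sums are differences of partial sums of the
    convergent series of [sqn (c i)]. *)
Lemma comb_cvg e c (m : R) : onb e -> (forall n, \sum_(i < n) sqn (c i) <= m) ->
  exists w, norm_lim (fun n => \sum_(i < n) c i *: e i) w /\
    forall k, ip w (e k) = c k.
Proof.
move=> eo cm; have eo' := onb_orthofamily eo.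
have c0 n : 0 <= sqn (c n) := sqn_ge0 _.
have nd := nondecreasing_psum c0.
have [l sl sle] := nondecreasing_cvgn_bounded nd cm.
have [w ew] : exists w, norm_lim (fun n => \sum_(i < n) c i *: e i) w.
  apply: ip_complete => eps e0.
  have [n0 h] := cvgn_eps sl e0; exists n0 => m' n n0n nm.
  rewrite -/(nsq _).
  (* A difference of partial sums is a single combination with the first [n] coefficients set to 0,
     so [nsq_comb] computes its norm. *)
  have -> : \sum_(i < m') c i *: e i - \sum_(i < n) c i *: e i =
     \sum_(i < m') (if (i < n)%N then 0 else c i) *: e i.
    apply/eqP; rewrite subr_eq (big_ord_widen _ (fun i => c i *: e i) nm).
    rewrite [X in _ == _ + X]big_mkcond/= -big_split/=; apply/eqP; apply: eq_bigr => i _.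
    by case: ltnP; rewrite ?scale0r ?add0r ?addr0.
  rewrite (nsq_comb (fun i => if (i < n)%N then 0 else c i))//.
  have -> : \sum_(i < m') sqn (if (i < n)%N then 0 else c i) * nsq (e i) =
     \sum_(i < m') sqn (c i) - \sum_(i < n) sqn (c i).
    apply/esym/eqP; rewrite subr_eq (big_ord_widen _ (fun i => sqn (c i)) nm).
    rewrite [X in _ == _ + X]big_mkcond/= -big_split/=; apply/eqP.
    apply: eq_bigr => i _; rewrite (onb_nsq _ eo) mulr1.
    by case: ltnP; rewrite ?sqn0 ?add0r ?addr0.
  have := h _ n0n; have := sle m'; lra.
exists w; split=> // k; apply: (norm_lim_ip ew).
near=> n; rewrite (ip_comb c)// (onb_nsq _ eo) mulr1 ifT//.
by near: n; exists k.+1.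
Unshelve. all: by end_near. Qed.

(** The partial expansions converge to some [w] with the coefficients of [u], and completeness of
    the basis makes [w - u] null. *)
Lemma parseval_proj e u : onb e -> norm_lim (fun n => proj e n u) u.
Proof.
move=> eo.
have [w [ew we]] := @comb_cvg e (fun i => ip u (e i)) _ eo
  (fun n => bessel n u (onb_orthofamily eo)).
have uw : nsq (w - u) = 0.
  by apply: eo.2 => n; rewrite (sipBl sip) we subrr.
apply: (@cvgn0_le _ _ (fun n => 2 * nsq (proj e n u - w))).
  move=> n; rewrite nsq_ge0/=.
  have := nsqD_le (proj e n u - w) (w - u).
  by rewrite addrA subrK uw; lra.
rewrite -[X in _ --> X](mulr0 2); apply: cvgM => //; exact: cvg_cst.
Qed.

Lemma parseval e u : onb e ->
  \sum_(i < n) sqn (ip u (e i)) @[n --> \oo] --> nsq u.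
Proof.
move=> eo; have /cvgrPdist_lt h := parseval_proj u eo.
apply/cvgrPdist_lt => eps /h; apply: filterS => n.
rewrite sub0r normrN ger0_norm ?nsq_ge0//.
suff -> : nsq (proj e n u - u) = nsq u - \sum_(i < n) sqn (ip u (e i)).
  by rewrite ger0_norm// subr_ge0 bessel//; exact: onb_orthofamily.
set p := proj e n u.
have pp : nsq p = \sum_(i < n) sqn (ip u (e i)).
  rewrite /p /proj (nsq_comb (fun i => ip u (e i))); last exact: onb_orthofamily.
  by apply: eq_bigr => i _; rewrite (onb_nsq _ eo) mulr1.
have up : Re (ip u p) = \sum_(i < n) sqn (ip u (e i)).
  rewrite (sip_sumr sip) Re_sum; apply: eq_bigr => i _.
  by rewrite (sipZr sip) mulrC mulC_sqn.
rewrite -pp in up *; rewrite /nsq !(sipE sip) (sip_conj sip u p) !partsE up.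
rewrite -/(nsq p); ring.
Qed.

(* [ip u v] as a limit, in a form that avoids a topology on [R[i]] *)
Lemma parseval_ip e u v : onb e ->
  sqn (\sum_(i < n) ip u (e i) * ip (e i) v - ip u v) @[n --> \oo] --> 0.
Proof.
move=> eo; have h := parseval_proj u eo.
apply: (@cvgn0_le _ _ (fun n => nsq (proj e n u - u) * nsq v)).
  move=> n; rewrite sqn_ge0/= (le_trans _ (ip_le _ _))//.
  rewrite (sipBl sip) (sip_suml sip).
  by under [in X in _ <= X]eq_bigr do rewrite (sipZl sip).
rewrite -[X in _ --> X](mul0r (nsq v)); apply: cvgM => //; exact: cvg_cst.
Qed.

(** The representing vector has coefficients conj (f e_i). They are square summable because their
    n-th partial combination v satisfies f v = |v|^2 and |f v|^2 <= c |v|^2, hence |v|^2 <= c. *)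
Lemma riesz e (f : H -> R[i]) (c : R) : onb e ->
  (forall a u v, f (a *: u + v) = a * f u + f v) ->
  (forall u, sqn (f u) <= c * nsq u) ->
  exists w, forall u, ip u w = f u.
Proof.
move=> eo fl fc; have eo' := onb_orthofamily eo.
have fD u v : f (u + v) = f u + f v by rewrite -[u]scale1r fl mul1r scale1r.
have f0 : f 0 = 0 by apply: (addrI (f 0)); rewrite -fD !addr0.
have fZ a u : f (a *: u) = a * f u by rewrite -[a *: u]addr0 fl f0 addr0.
have fsum n (F : 'I_n -> H) : f (\sum_(i < n) F i) = \sum_(i < n) f (F i).
  by elim/big_rec2: _ => // i x y _ <-; rewrite fD.
have [w [_ we]] : exists w, norm_lim (fun n => \sum_(i < n) (f (e i))^* *: e i) w /\
    forall k, ip w (e k) = (f (e k))^*.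
  apply: (@comb_cvg e (fun i => (f (e i))^*) c) => // n.
  set v := \sum_(i < n) (f (e i))^* *: e i.
  have vv : nsq v = \sum_(i < n) sqn ((f (e i))^*).
    rewrite /v (nsq_comb (fun i => (f (e i))^*))//.
    by apply: eq_bigr => i _; rewrite (onb_nsq _ eo) mulr1.
  have fv : f v = (nsq v)%:C.
    rewrite vv fsum; apply: complexP; rewrite ?cReC ?cImC ?Re_sum ?Im_sum.
      by apply: eq_bigr => i _; rewrite fZ mulrC mulC_sqn sqnJ.
    by rewrite big1// => i _; rewrite fZ mulrC mulC_sqn.
  have := fc v; rewrite fv sqnC -vv.
  have [->|v0] := eqVneq (nsq v) 0.
    (* What is left is [0 <= c], read off from the bound at the unit vector [e 0]. *)
    by have := le_trans (sqn_ge0 _) (fc (e 0)); rewrite (onb_nsq _ eo) mulr1.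
  by rewrite expr2 ler_pM2r// lt_def v0 nsq_ge0.
exists w => u; apply/esym/subr0_eq/sqn_eq0; apply/eqP.
rewrite eq_le sqn_ge0 andbT.
have hu : (2 * c + 2 * nsq w) * nsq (proj e n u - u) @[n --> \oo] --> 0.
  rewrite -[X in _ --> X](mulr0 (2 * c + 2 * nsq w)); apply: cvgM.
    exact: cvg_cst.
  exact: parseval_proj.
apply: cvgn_ge_cst hu => n; set x := proj e n u.
have x0 : f x = ip x w.
  rewrite fsum (sip_suml sip); apply: eq_bigr => i _.
  by rewrite fZ (sipZl sip) (sip_conj sip w) we conjCK.
have -> : f u - ip u w = ip (x - u) w - f (x - u).
  by rewrite fD (sipBl sip) -x0 -scaleN1r fZ; ring.
rewrite (le_trans (sqnD_le _ _))// sqnN.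
have := ip_le (x - u) w; have := fc (x - u); lra.
Qed.

End hilbert_theory.

(** * Spectral theorem for positive operators with summable diagonal *)

Section positive_operators.
Variables (R : realType) (H : hilbert R).
Local Notation Re := complex.Re.
Local Notation Im := complex.Im.
Local Notation sip := (ip_sip H).
Local Notation nsq := (@nsq R H).
Implicit Types (u v w x : H) (e : nat -> H) (T K : H -> H).

Definition quad T u : R := Re (ip (T u) u).

Definition positive_symmetric T :=
  (forall u v, ip (T u) v = ip u (T v)) /\ (forall u, 0 <= quad T u).

Lemma positive_symmetric_sip T : positive_symmetric T ->
  semi_inner_product (fun u v => ip (T u) v).
Proof.
move=> [Ts T0]; split=> [a u v w|u v|u]; last exact: T0.
  by rewrite !Ts (sip_linear sip).
by rewrite Ts (sip_conj sip).
Qed.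

(** Cauchy-Schwarz for the form <T u, v> at u and T u: |T u|^4 <= <T u, u> <T T u, T u> <= <T u, u>
    c |T u|^2. *)
Lemma nsq_le_quad T (c : R) : positive_symmetric T ->
  (forall u, quad T u <= c * nsq u) -> forall u, nsq (T u) <= c * quad T u.
Proof.
move=> Tps Tc u.
have := sip_CauchySchwarz (positive_symmetric_sip Tps) u (T u).
rewrite (sip_diag sip (T u)) sqnC -/(nsq _) -/(quad T u) -/(quad T (T u)) => h.
have q0 : 0 <= quad T u := Tps.2 u.
(* When [T u] is null the goal is [0 <= c * quad T u]: either [u] is null and so is its quadratic
   form, or [0 <= quad T u <= c * nsq u] gives the sign of [c]. *)
have [k0|k0] := eqVneq (nsq (T u)) 0.
  have := nsq_ge0 u; rewrite k0 le_eqVlt => /predU1P[u0|u0].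
    by rewrite /quad (Tps.1 u u) (sip_null sip) ?mulr0.
  rewrite mulr_ge0// -(pmulr_lge0 _ u0); exact: le_trans (Tc u).
have {}k0 : 0 < nsq (T u) by rewrite lt_def k0 nsq_ge0.
rewrite -(ler_pM2r k0) -expr2 (le_trans h)//.
by rewrite (mulrC c) -mulrA ler_wpM2l.
Qed.

Section contraction.
Variable K : H -> H.
Hypotheses (Kps : positive_symmetric K) (K1 : forall u, quad K u <= nsq u).

Let Ks u v : ip (K u) v = ip u (K v). Proof. exact: Kps.1. Qed.

Lemma ip_iter k u v : ip (iter k K u) v = ip u (iter k K v).
Proof. by elim: k u v => // k IH u v; rewrite iterS Ks IH -iterSr. Qed.

(** The k-th moment of what would be the spectral measure of [v] on [0, 1]. The lemmas below are the
    elementary properties of x^k on this interval: nonnegative, decreasing and convex in k, and 1 -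
    x^k <= k (1 - x). *)
Definition moment k v : R := Re (ip (iter k K v) v).

Lemma moment_even k v : moment (k + k) v = nsq (iter k K v).
Proof. by rewrite /moment iterD ip_iter. Qed.

Lemma moment_odd k v : moment (k + k).+1 v = quad K (iter k K v).
Proof. by rewrite /moment /quad -addnS iterD ip_iter. Qed.

Lemma even_or_odd k : exists j, k = (j + j)%N \/ k = (j + j).+1.
Proof.
exists k./2; rewrite addnn -[X in X = _ \/ X = _](odd_double_half k).
by case: odd; [right|left].
Qed.

Lemma moment_ge0 k v : 0 <= moment k v.
Proof.
have [j [->|->]] := even_or_odd k; first by rewrite moment_even nsq_ge0.
by rewrite moment_odd; exact: Kps.2.
Qed.

(** With x the j-th iterate of [v], a step from an even index is <K x, x> <= |x|^2 and a step from
    an odd one is |K x|^2 <= <K x, x>. *)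
Lemma moment_decr v : {homo (moment^~ v) : i j / (i <= j)%N >-> i >= j}.
Proof.
apply: homo_leq => [//|x y z xy yz|n]; first exact: le_trans yz xy.
have [j [->|->]] := even_or_odd n; first by rewrite moment_odd moment_even.
rewrite moment_odd (_ : (j + j).+2 = j.+1 + j.+1)%N; last by rewrite addSn addnS.
rewrite moment_even iterS -[leRHS]mul1r; apply: nsq_le_quad => // u.
by rewrite mul1r.
Qed.

(** This is [moment_ge0] at the vector [u - K u], that is x^k (1 - x)^2 >= 0. *)
Lemma moment_convex k u :
  moment k.+1 u - moment k.+2 u <= moment k u - moment k.+1 u.
Proof.
have := moment_ge0 k (u - K u).
rewrite {1}/moment ip_iter (sipBl sip) Ks -iterS -!ip_iter !(sipBr sip).
by rewrite -!Ks -!iterS !partsE -!/(moment _ _); lra.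
Qed.

Lemma moment_ge k u : nsq u - moment k u <= k%:R * (nsq u - quad K u).
Proof.
have dec j : moment j u - moment j.+1 u <= nsq u - quad K u.
  by elim: j => // j; apply: le_trans; exact: moment_convex.
elim: k => [|k IH]; first by rewrite mul0r subrr.
by have := dec k; rewrite -addn1 natrD mulrDl mul1r addn1; lra.
Qed.

(* [iter k K v] is Cauchy since its squared increments are second differences
   of the decreasing sequence of moments; no compactness is involved. *)
Lemma iter_cvg v : exists w, norm_lim (fun k => iter k K v) w /\
  forall x, ip (K w) x = ip w x.
Proof.
have [l ml lm] := nonincreasing_cvgn_bounded (@moment_decr v) (fun k => moment_ge0 k v).
have [w vw] : exists w, norm_lim (fun k => iter k K v) w.
  apply: ip_complete => eps e0; have e2 : 0 < eps / 2 by lra.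
  have [n0 h] := cvgn_eps ml e2; exists n0 => m n n0n nm.
  rewrite (sipBl sip) !(sipBr sip) !ip_iter -!iterD !(sip_conj sip (iter _ _ _)).
  rewrite !partsE -!/(moment _ _).
  have n0m := leq_trans n0n nm.
  have l1 : (n0 <= m + m)%N by rewrite (leq_trans n0m)// leq_addr.
  have l2 : (n0 <= n + n)%N by rewrite (leq_trans n0n)// leq_addr.
  have := h _ l1; have := h _ l2; have := lm (m + n)%N; have := lm (n + m)%N.
  move=> ? ? /andP[_ ?] /andP[_ ?]; lra.
exists w; split=> // x; rewrite Ks; apply/subr0_eq/sqn_eq0/eqP.
rewrite eq_le sqn_ge0 andbT.
pose d n := nsq (iter n K v - w).
have h : 2 * (d n * nsq (K x)) + 2 * (d n.+1 * nsq x) @[n --> \oo] -->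
    2 * (0 * nsq (K x)) + 2 * (0 * nsq x).
  apply: cvgD; apply: cvgM; try exact: cvg_cst; apply: cvgM; try exact: cvg_cst.
    exact: vw.
  by rewrite (cvg_shiftS d).
rewrite !mul0r !mulr0 addr0 in h; apply: cvgn_ge_cst h => n.
have -> : ip w (K x) - ip w x =
    - ip (iter n K v - w) (K x) + ip (iter n.+1 K v - w) x.
  by rewrite !(sipBl sip) iterS Ks; ring.
rewrite (le_trans (sqnD_le _ _))// sqnN.
by apply: lerD; rewrite ler_pM2l// ip_le.
Qed.

Lemma iter_cvg0 v : (forall w, (forall x, ip (K w) x = ip w x) -> nsq w = 0) ->
  nsq (iter k K v) @[k --> \oo] --> 0.
Proof.
move=> h; have [w [vw /h w0]] := iter_cvg v.
apply: (@cvgn0_le _ _ (fun k => 2 * nsq (iter k K v - w))).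
  move=> k; rewrite nsq_ge0/=.
  have := nsqD_le (iter k K v - w) w.
  by rewrite subrK w0; lra.
rewrite -[X in _ --> X](mulr0 2); apply: cvgM => //; exact: cvg_cst.
Qed.

(** If there were no fixed vector, all iterates would tend to 0. The sum of |K^k e_i|^2 over i, the
    squared Hilbert-Schmidt norm of K^k, would then drop to 1/2 for some k, so that |K^k u|^2 <=
    |u|^2 / 2 for all u. But a vector u with <K u, u> close enough to |u|^2 satisfies |K^k u|^2 >=
    3/4 |u|^2. *)
Lemma fixed_vector e (tau : R) : onb e ->
  (forall n, \sum_(i < n) quad K (e i) <= tau) ->
  (forall d : R, 0 < d -> exists u, (1 - d) * nsq u < quad K u) ->
  exists w, (forall x, ip (K w) x = ip w x) /\ 0 < nsq w.
Proof.
move=> eo Ktau Ktop; apply: contrapT => /forallNP nofix.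
have {}nofix w : (forall x, ip (K w) x = ip w x) -> nsq w = 0.
  move=> Kw; apply/eqP; rewrite eq_le nsq_ge0 andbT leNgt; apply/negP => w0.
  exact: (nofix w).
have t0 n : 0 <= quad K (e n) := Kps.2 _.
have [l tl lt] := nondecreasing_cvgn_bounded (nondecreasing_psum t0) Ktau.
(* One quarter for the tail of the diagonal, uniformly in the exponent, and one quarter for its
   first [n0] terms. *)
have q4 : 0 < 4^-1 :> R by rewrite invr_gt0.
have [n0 /(_ _ (leqnn n0))/andP[n0l _]] := cvgn_eps tl q4.
have : \sum_(i < n0) nsq (iter k K (e i)) @[k --> \oo] --> \sum_(i < n0) (0 : R).
  apply: (@cvgn_sum _ (fun i k => nsq (iter k K (e i))) (fun=> 0)) => i.
  exact: iter_cvg0.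
(* The successor makes [k] positive: the tail is estimated by moment 2k <= moment 1, and 2k is
   divided by below. *)
rewrite big1// => /cvgn_eps/(_ _ q4)[k0 /(_ k0.+1 (leqnSn _))/andP[_]].
rewrite add0r; set k := k0.+1 => k4.
have Ke n : \sum_(i < n) nsq (iter k K (e i)) <= 2^-1.
  have := nondecreasing_psum (fun i => nsq_ge0 (iter k K (e i))) (leq_addl n0 n).
  move=> /le_trans; apply; rewrite big_split_ord/=.
  have : \sum_(i < n) nsq (iter k K (e (n0 + i)%N)) <=
      \sum_(i < n) quad K (e (n0 + i)%N).
    by apply: ler_sum => i _; rewrite -moment_even (@moment_decr _ 1).
  have := lt (n0 + n)%N; rewrite big_split_ord/=.
  have : 4^-1 + 4^-1 = 2^-1 :> R by field.
  lra.
(* Parseval for the iterate of [u], whose coefficients <u, K^k e_i> are bounded by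
   Cauchy-Schwarz. *)
have contr u : nsq (iter k K u) <= nsq u / 2.
  apply: cvgn_le_cst (@parseval _ _ e (iter k K u) eo) => n.
  rewrite (@le_trans _ _ (\sum_(i < n) nsq u * nsq (iter k K (e i))))//.
    by apply: ler_sum => i _; rewrite ip_iter ip_le.
  by rewrite -mulr_sumr ler_wpM2l ?nsq_ge0.
(* By [moment_ge] a defect of 1 / (8k) in <K u, u> grows to at most 1/4 after 2k steps. *)
have k8 : 0 < 4 * (k + k)%:R :> R by rewrite mulr_gt0// ltr0n.
have [u ut] : exists u, (1 - (4 * (k + k)%:R)^-1) * nsq u < quad K u.
  by apply: Ktop; rewrite invr_gt0.
have := moment_ge (k + k) u; rewrite moment_even.
have := contr u.
have {}ut : (k + k)%:R * (nsq u - quad K u) < 4^-1 * nsq u.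
  have kk : 0 < (k + k)%:R :> R by rewrite ltr0n.
  rewrite -ltr_pdivlMl//.
  have -> : (k + k)%:R^-1 * (4^-1 * nsq u) = (4 * (k + k)%:R)^-1 * nsq u.
    by rewrite invfM mulrA (mulrC _ 4^-1).
  by lra.
have := nsq_ge0 u; lra.
Qed.

End contraction.

End positive_operators.

(** * Deflation and the eigenvector expansion *)

Section spectral_theorem.
Variables (R : realType) (H : hilbert R) (e : nat -> H).
Hypothesis eo : onb e.
Local Notation Re := complex.Re.
Local Notation Im := complex.Im.
Local Notation sip := (ip_sip H).
Local Notation nsq := (@nsq R H).
Implicit Types (u v w x : H) (T : H -> H) (s : R).

Definition deflate T s w : H -> H := fun u => T u - (s%:C * ip u w) *: w.

Definition summable_diagonal T :=
  exists tau : R, forall n, \sum_(i < n) quad T (e i) <= tau.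

Definition bounded_form T := exists c : R, forall u, quad T u <= c * nsq u.

Definition trace_form T :=
  [/\ positive_symmetric T, bounded_form T & summable_diagonal T].

(** The alternative [s = 0], [w = 0] covers a null quadratic form, so that deflation can continue
    forever after a finite rank is exhausted. *)
Definition top_eigenpair T s w :=
  [/\ 0 <= s, forall x, ip (T w) x = s%:C * ip w x,
      0 < s /\ nsq w = 1 \/ s = 0 /\ w = 0 & forall u, quad T u <= s * nsq u].

(** The least nonnegative bound of the quadratic form, which for a positive operator is its norm. It
    is attained as a bound: for [u] not null, divide by [nsq u] and pass to the infimum. *)
Lemma quad_le_inf T : bounded_form T -> exists2 m : R, 0 <= m &
  (forall u, quad T u <= m * nsq u) /\
  forall c : R, 0 <= c -> (forall u, quad T u <= c * nsq u) -> m <= c.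
Proof.
move=> [c0 Tc0].
pose A := [set c : R | 0 <= c /\ forall u, quad T u <= c * nsq u].
have A0 : A !=set0.
  exists (Num.max c0 0); split; first by rewrite le_max lexx orbT.
  by move=> u; rewrite (le_trans (Tc0 u))// ler_wpM2r ?nsq_ge0// le_max lexx.
have Alb : lbound A 0 by move=> c [].
have Ainf : has_inf A by split=> //; exists 0.
exists (inf A); first exact: lb_le_inf.
split=> [u|c c1 cT]; last by apply: ge_inf; [exists 0|].
have [u0|u0] := eqVneq (nsq u) 0.
  by have [c [_ /(_ u)]] := A0; rewrite u0 !mulr0.
have {}u0 : 0 < nsq u by rewrite lt_def u0 nsq_ge0.
rewrite -ler_pdivrMr//; apply: lb_le_inf => // c [_ cT].
by rewrite ler_pdivrMr.
Qed.

Lemma top_eigenpair_exists T : trace_form T ->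
  exists p : R * H, top_eigenpair T p.1 p.2.
Proof.
move=> [[Ts T0] Tb [tau Ttau]]; have [m m0 [Tm mmin]] := quad_le_inf Tb.
have [mz|mz] := eqVneq m 0.
  exists (0, 0); split=> //=; last by move=> u; rewrite -mz.
    by move=> x; rewrite Ts !(sip0l sip) mulr0.
  by right.
have {mz}m0 : 0 < m by rewrite lt_def mz.
pose K u := (m^-1)%:C *: T u.
have qK u : quad K u = m^-1 * quad T u.
  by rewrite /quad (sipZl sip) !partsE mul0r subr0.
have Kps : positive_symmetric K.
  split=> [u v|u]; last by rewrite qK mulr_ge0// invr_ge0 ltW.
  rewrite (sipZl sip) (sipZr sip) Ts; congr (_ * _).
  by apply: complexP; rewrite !partsE ?oppr0.
have K1 u : quad K u <= nsq u by rewrite qK ler_pdivrMl.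
have Ktau n : \sum_(i < n) quad K (e i) <= m^-1 * tau.
  under eq_bigr do rewrite qK.
  by rewrite -mulr_sumr ler_wpM2l// invr_ge0 ltW.
have [d d0|w [Kw w0]] := fixed_vector Kps K1 eo Ktau.
  apply: contrapT => /forallNP nex.
  (* Without such a [u] there would be a bound smaller than [m]; the maximum with 0 keeps it
     admissible when [d > 1]. *)
  have {}nex u : quad T u <= Num.max (m * (1 - d)) 0 * nsq u.
    have /negP := nex u; rewrite -leNgt qK ler_pdivrMl// mulrA => /le_trans; apply.
    by rewrite ler_wpM2r ?nsq_ge0// le_max lexx.
  have := mmin _ _ nex; rewrite le_max lexx orbT => /(_ isT).
  by rewrite le_max => /orP[]; nra.
pose a := (Num.sqrt (nsq w))^-1.
have a2 : a ^+ 2 * nsq w = 1.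
  by rewrite exprVn sqr_sqrtr ?nsq_ge0// mulVf// gt_eqF.
exists (m, a%:C *: w); split=> //=; [exact: ltW| |left; split=> //].
  move=> x; rewrite Ts !(sipZl sip) -Ts mulrCA; congr (_ * _).
  rewrite -(Kw x) (sipZl sip) mulrA -rmorphM/= mulfV ?gt_eqF//.
  by rewrite mul1r.
by rewrite nsqZ sqnC.
Qed.

Section deflate.
Variables (T : H -> H) (s : R) (w : H).
Hypotheses (Tt : trace_form T) (sw : top_eigenpair T s w).

Lemma quad_deflate u : quad (deflate T s w) u = quad T u - s * sqn (ip u w).
Proof.
rewrite /quad (sipBl sip) (sipZl sip) (sip_conj sip u w) -mulrA mulC_sqn.
by rewrite !partsE; ring.
Qed.

(** The quadratic form of the deflated operator at [u] is that of [T] at the component of [u]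
    orthogonal to the unit eigenvector [w]. *)
Lemma deflate_positive : positive_symmetric (deflate T s w).
Proof.
have [[Ts T0] _ _] := Tt; have [s0 Tw w1 _] := sw; split=> [u v|u].
  rewrite (sipBl sip) (sipBr sip) Ts (sipZl sip) (sipZr sip); congr (_ - _).
  rewrite (sip_conj sip v w); apply: complexP; rewrite !partsE; ring.
rewrite quad_deflate; case: w1 => [[_ w1]|[-> _]]; last by rewrite mul0r subr0.
have := T0 (u - ip u w *: w).
have bS := positive_symmetric_sip (conj Ts T0).
rewrite /quad !(sipBl bS) !(sipBr bS) !(sipZl bS) !(sipZr bS).
rewrite (sip_conj bS w u) !Tw (sip_diag sip w) -/(nsq w) w1 (sip_conj sip u w).
rewrite /sqn !partsE; lra.
Qed.

Lemma deflate_trace_form : trace_form (deflate T s w).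
Proof.
have [_ [c Tc] [tau Ttau]] := Tt; have [s0 _ _ _] := sw.
have le u : quad (deflate T s w) u <= quad T u.
  by rewrite quad_deflate gerBl mulr_ge0 ?sqn_ge0.
split; first exact: deflate_positive.
- by exists c => u; rewrite (le_trans (le u)).
- exists tau => n; rewrite (le_trans _ (Ttau n))//.
  by apply: ler_sum => i _; exact: le.
Qed.

End deflate.

(** The expansion is stated for the quadratic form, as a series of nonnegative reals: this is the
    form in which traces can be exchanged. Indices with [s i = 0] are padding; vectors of the kernel
    are not listed. *)
Record eigen_decomposition T (s : nat -> R) (phi : nat -> H) : Prop := {
  eigdec_ge0 : forall i, 0 <= s i;
  eigdec_eigen : forall i x, ip (T (phi i)) x = (s i)%:C * ip (phi i) x;
  eigdec_ortho : forall i j, i <> j -> ip (phi i) (phi j) = 0;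
  eigdec_unit : forall i, 0 < s i /\ nsq (phi i) = 1 \/ s i = 0 /\ phi i = 0;
  eigdec_sum : forall u,
    \sum_(i < n) s i * sqn (ip u (phi i)) @[n --> \oo] --> quad T u }.

Lemma eigdec_orthofamily T (s : nat -> R) phi :
  eigen_decomposition T s phi -> orthofamily phi.
Proof.
move=> Tsp; split=> [i j ij|i]; first exact: (eigdec_ortho Tsp).
have [[_ ->]//|[_ ->]] := eigdec_unit Tsp i.
by rewrite /nsq (sip0l sip) ler01.
Qed.

Lemma eigdec_nsq T (s : nat -> R) phi i :
  eigen_decomposition T s phi -> s i * nsq (phi i) = s i.
Proof.
by move=> Tsp; have [[_ ->]|[-> _]] := eigdec_unit Tsp i; rewrite ?mulr1 ?mul0r.
Qed.

(** After n deflations the remainder of the expansion at [u] is the quadratic form of [D n], at most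
    [s n * nsq u]. It tends to 0 because the [s i] have bounded partial sums. *)
Theorem eigen_decomposition_exists T : trace_form T ->
  exists (s : nat -> R) phi, eigen_decomposition T s phi.
Proof.
move=> T0.
(* A top eigenpair is chosen for every map, with a dummy value outside [trace_form], so that the
   recursion [D] carries no proofs. *)
have /(_ _)/cid-/all_sig[f fP] : forall T, exists p : R * H,
    trace_form T -> top_eigenpair T p.1 p.2.
  move=> T'; have [/top_eigenpair_exists[p ?]|nT'] := pselect (trace_form T').
    by exists p.
  by exists (0, 0) => /nT'.
pose D := fix D n : H -> H :=
  if n is n'.+1 then deflate (D n') (f (D n')).1 (f (D n')).2 else T.
pose s n := (f (D n)).1; pose phi n := (f (D n)).2.
have Dt n : trace_form (D n).
  by elim: n => // n IH; apply: deflate_trace_form => //; exact: fP.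
have top n : top_eigenpair (D n) (s n) (phi n) := fP _ (Dt n).
have s0 n : 0 <= s n by have [] := top n.
have unit n : 0 < s n /\ nsq (phi n) = 1 \/ s n = 0 /\ phi n = 0.
  by have [] := top n.
have Ds n u v : ip (D n u) v = ip u (D n v) by have [[]] := Dt n.
have DS n u x :
    ip (D n.+1 u) x = ip (D n u) x - (s n)%:C * ip u (phi n) * ip (phi n) x.
  by rewrite (sipBl sip) (sipZl sip).
have Dphi n x : ip (D n (phi n)) x = (s n)%:C * ip (phi n) x.
  by have [] := top n.
have sC n : s n != 0 -> (s n)%:C != 0 :> R[i] by apply: contra => /eqP [->].
(* A vector in the kernel of the symmetric [D n] is orthogonal to its eigenvector [phi n] for
   [s n > 0]. *)
have kernel_ortho n i : (forall x, ip (D n (phi i)) x = 0) ->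
    ip (phi i) (phi n) = 0.
  move=> ker; have [[sn _]|[_ ->]] := unit n; last by rewrite (sip0r sip).
  have /eqP := Dphi n (phi i).
  have {}sn : (s n)%:C != 0 :> R[i] by rewrite sC// gt_eqF.
  rewrite Ds (sip_conj sip) ker conjC0 eq_sym mulf_eq0 (negPf sn)/=.
  by move=> /eqP h; rewrite (sip_conj sip (phi n)) h conjC0.
have ker n i x : (i < n)%N -> ip (D n (phi i)) x = 0.
  elim: n x => // n IH x; rewrite ltnS leq_eqVlt => /orP[/eqP->|i_n].
    rewrite DS Dphi; have [[_ n1]|[-> _]] := unit n; last by rewrite !mul0r subr0.
    by rewrite (sip_diag sip) -/(nsq _) n1 mulr1 subrr.
  by rewrite DS IH// kernel_ortho ?mulr0 ?mul0r ?subr0// => y; exact: IH.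
have ortho_lt i j : (i < j)%N -> ip (phi i) (phi j) = 0.
  by move=> ij; apply: kernel_ortho => x; exact: ker.
have ortho i j : i <> j -> ip (phi i) (phi j) = 0.
  move=> /eqP; rewrite neq_ltn => /orP[|ji]; first exact: ortho_lt.
  by rewrite (sip_conj sip) ortho_lt// conjC0.
(* Descending from [D i]: undoing a deflation adds a multiple of some [phi n] with [n < i], whose
   coefficient vanishes by orthogonality. *)
have eigen n i x : (n <= i)%N -> ip (D n (phi i)) x = (s i)%:C * ip (phi i) x.
  move=> ni; rewrite -(subKn ni).
  elim: (i - n)%N (leq_subr n i) => [|k IH] ki; first by rewrite subn0 Dphi.
  rewrite -IH; last exact: ltnW.
  have ->: (i - k = (i - k.+1).+1)%N by rewrite subnSK.
  rewrite DS ortho ?mulr0 ?mul0r ?subr0//.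
  by lia.
have quadD n u : quad (D n) u = quad T u - \sum_(i < n) s i * sqn (ip u (phi i)).
  elim: n => [|n IH]; first by rewrite big_ord0 subr0.
  by rewrite big_ord_recr/= quad_deflate IH opprD addrA.
have quadD0 n u : 0 <= quad (D n) u by have [[]] := Dt n.
have quadDle n u : quad (D n) u <= s n * nsq u by have [] := top n.
have snsq i : s i * nsq (phi i) = s i.
  by have [[_ ->]|[-> _]] := unit i; rewrite ?mulr1 ?mul0r.
have [_ _ [tau Ttau]] := T0.
(* Compute each |phi_i|^2 by Parseval in the basis [e]. For a truncation at [N], the excess of the
   diagonal of [T] over the double sum is the sum of [quad (D n) (e k)], which is nonnegative. *)
have stau n : \sum_(i < n) s i <= tau.
  have lim : \sum_(i < n) s i * (\sum_(k < N) sqn (ip (phi i) (e k)))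
      @[N --> \oo] --> \sum_(i < n) s i.
    under [X in _ --> X]eq_bigr do rewrite -snsq.
    apply: (@cvgn_sum _ (fun i N => s i * (\sum_(k < N) sqn (ip (phi i) (e k))))
       (fun i => s i * nsq (phi i))) => i.
    by apply: cvgM; [exact: cvg_cst|exact: parseval].
  apply: cvgn_le_cst lim => N; rewrite (le_trans _ (Ttau N))//.
  rewrite -subr_ge0; under [X in _ - X]eq_bigr do rewrite mulr_sumr.
  rewrite exchange_big/= -sumrB; apply: sumr_ge0 => k _.
  under eq_bigr do rewrite sqn_ipC.
  by rewrite -quadD.
have [l sl _] := nondecreasing_cvgn_bounded (nondecreasing_psum s0) stau.
have s_0 := psum_cvgn0 sl.
exists s, phi; split=> // [i x|u]; first exact: (eigen 0).
rewrite -[X in _ --> X]subr0.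
have -> : (fun n => \sum_(i < n) s i * sqn (ip u (phi i))) =
    (fun n => quad T u - quad (D n) u).
  by apply/funext => n; rewrite quadD; ring.
apply: cvgB; first exact: cvg_cst.
apply: (@cvgn0_le _ _ (fun n => s n * nsq u)); first by move=> n; apply/andP.
by rewrite -[X in _ --> X](mul0r (nsq u)); apply: cvgM => //; exact: cvg_cst.
Qed.

End spectral_theorem.

(** * Eigenvalue sums as traces *)

Section nonnegative_series.
Variable R : realType.
Implicit Types (x : nat -> R) (l : R).

Lemma nneseries_psum x l : (forall n, 0 <= x n) ->
  \sum_(i < n) x i @[n --> \oo] --> l ->
  (\sum_(0 <= i <oo) (x i)%:E)%E = l%:E.
Proof.
move=> x0 xl; apply/cvg_lim => //.
under eq_fun do rewrite big_mkord sumEFin.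
by apply/cvg_EFin; [exact: nearW|].
Qed.

Lemma psum_nneseries x l : (forall n, 0 <= x n) ->
  (\sum_(0 <= i <oo) (x i)%:E)%E = l%:E ->
  \sum_(i < n) x i @[n --> \oo] --> l.
Proof.
move=> x0 xl.
have xle n : \sum_(i < n) x i <= l.
  rewrite -lee_fin -xl -sumEFin -(big_mkord xpredT (fun i => (x i)%:E)).
  by apply: nneseries_lim_ge => i _ _; rewrite lee_fin.
have [m xm _] := nondecreasing_cvgn_bounded (nondecreasing_psum x0) xle.
suff -> : l = m by [].
by apply: EFin_inj; rewrite -xl; exact: nneseries_psum.
Qed.

End nonnegative_series.

Section spectral_traces.
Variables (R : realType) (H : hilbert R) (T : H -> H).
Variables (s : nat -> R) (phi : nat -> H).
Local Notation sip := (ip_sip H).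
Hypothesis Tps : positive_symmetric T.
Hypothesis Tsp : eigen_decomposition T s phi.

(** Tonelli on the double series s_i |<f_k, phi_i>|^2. Only Parseval's identity is asked of [f], as
    it will be applied both to a basis and to its images under the adjoint of a time-frequency
    shift. *)
Lemma trace_spectral (f : nat -> H) :
  (forall u, \sum_(k < n) sqn (ip u (f k)) @[n --> \oo] --> nsq u) ->
  (\sum_(0 <= k <oo) (quad T (f k))%:E = \sum_(0 <= i <oo) (s i)%:E)%E.
Proof.
move=> fpars; have s0 := eigdec_ge0 Tsp.
have ss0 i k : 0 <= s i * sqn (ip (f k) (phi i)) by rewrite mulr_ge0 ?sqn_ge0.
transitivity (\sum_(0 <= k <oo) \sum_(0 <= i <oo)
    (s i * sqn (ip (f k) (phi i)))%:E)%E.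
  apply: eq_eseriesr => k _; apply/esym/nneseries_psum => //.
  exact: (eigdec_sum Tsp).
rewrite nneseries_interchange; last by move=> *; rewrite lee_fin.
apply: eq_eseriesr => i _.
apply: (@nneseries_psum _ (fun k => s i * sqn (ip (f k) (phi i)))) => //.
rewrite -[X in _ --> X](eigdec_nsq i Tsp).
under eq_fun do rewrite -mulr_sumr; apply: cvgM; first exact: cvg_cst.
under eq_fun do under eq_bigr do rewrite sqn_ipC; exact: fpars.
Qed.

(** Since s_i <phi_i, e_k> = <phi_i, T e_k>, Bessel for the family [phi] bounds the sum over i of
    s_i^2 |<phi_i, e_k>|^2 by |T e_k|^2; then sum over k. *)
Lemma sum_sqr_spectral (e : nat -> H) (t : R) N : onb e ->
  (forall n, \sum_(k < n) nsq (T (e k)) <= t) -> \sum_(i < N) s i ^+ 2 <= t.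
Proof.
move=> eo et; have s0 := eigdec_ge0 Tsp.
have lim : \sum_(i < N) s i ^+ 2 * (\sum_(k < n) sqn (ip (phi i) (e k)))
    @[n --> \oo] --> \sum_(i < N) s i ^+ 2 * nsq (phi i).
  apply: (@cvgn_sum _
    (fun i n => s i ^+ 2 * (\sum_(k < n) sqn (ip (phi i) (e k))))
    (fun i => s i ^+ 2 * nsq (phi i))) => i.
  by apply: cvgM; [exact: cvg_cst|exact: parseval].
rewrite [X in _ --> X](_ : _ = \sum_(i < N) s i ^+ 2) in lim; last first.
  by apply: eq_bigr => i _; rewrite expr2 -mulrA (eigdec_nsq _ Tsp).
apply: cvgn_le_cst lim => n; rewrite (le_trans _ (et n))//.
under eq_bigr do rewrite mulr_sumr; rewrite exchange_big/=.
apply: ler_sum => k _.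
rewrite (le_trans _ (bessel N _ (eigdec_orthofamily Tsp)))//.
apply: ler_sum => i _.
by rewrite (sqn_ipC (T (e k))) -Tps.1 (eigdec_eigen Tsp) sqnM sqnC.
Qed.

End spectral_traces.

(** * The scalar entropy inequality *)

Section entropy_inequality.
Variable R : realType.

(** The bound ln y <= y - 1 at y = c x, multiplied by x. For x > 0 it is sharp at x = 1 / c, the
    value of all eigenvalues in the extremal case. *)
Lemma xlnx_ge (c x : R) : 0 < c -> 0 <= x ->
  ln c * x + x - c * x ^+ 2 <= - (x * ln x).
Proof.
move=> c0; rewrite le_eqVlt => /predU1P[<-|x0].
  by rewrite mulr0 mul0r expr0n/= mulr0; lra.
have cx : 0 < c * x by rewrite mulr_gt0.
have := @le_ln1Dx R (c * x - 1); rewrite (_ : 1 + _ = c * x); last by ring.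
rewrite lnM ?posrE// => h.
have {}h : ln c + ln x <= c * x - 1 by apply: h; lra.
by have := ler_wpM2l (ltW x0) h; rewrite expr2; lra.
Qed.

Lemma entropy_ge (s : nat -> R) (c t : R) (y : \bar R) : 0 < c ->
  (forall i, 0 <= s i) -> \sum_(i < n) s i @[n --> \oo] --> (1 : R) ->
  (forall n, \sum_(i < n) s i ^+ 2 <= t) ->
  (forall n, (\sum_(i < n) - (s i * ln (s i)))%:E <= y)%E ->
  ((ln c + 1 - c * t)%:E <= y)%E.
Proof.
move=> c0 s0 s1 st sy.
have h n : ((ln c * \sum_(i < n) s i + \sum_(i < n) s i - c * t)%:E <= y)%E.
  apply: le_trans (sy n); rewrite lee_fin.
  rewrite (@le_trans _ _ (\sum_(i < n) (ln c * s i + s i - c * s i ^+ 2)))//.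
    rewrite sumrB big_split/= -!mulr_sumr lerB// ler_pM2l//; exact: st.
  by apply: ler_sum => i _; exact: xlnx_ge.
(* The limit is taken in the reals, once [y] is finite; the empty sum [n = 0] excludes minus
   infinity. *)
case: y sy h => [y| |] sy h; last 2 first.
- by rewrite leey.
- by have := sy 0.
rewrite lee_fin.
have lim : ln c * (\sum_(i < n) s i) + \sum_(i < n) s i - c * t @[n --> \oo] -->
    ln c * 1 + 1 - c * t.
  apply: cvgB; last exact: cvg_cst.
  by apply: cvgD => //; apply: cvgM => //; exact: cvg_cst.
rewrite mulr1 in lim; apply: cvgn_le_cst lim => n.
by have := h n; rewrite lee_fin.
Qed.

End entropy_inequality.

(** * The Hilbert space L^2(R^d) *)

Section square_integrable.
Context d (T : measurableType d) (R : realType).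
Variable mu : {measure set T -> \bar R}.
Implicit Types f g : T -> R.

Lemma Lfun2P f : f \in Lfun mu 2%:E <->
  measurable_fun setT f /\ (\int[mu]_x (f x ^+ 2)%:E < +oo)%E.
Proof.
split=> [f2|[mf f2]].
  split; first by move: f2 => /[!inE] /andP[/[!inE]].
  have /integrableP[_] := Lfun2_integrable_sqr f2.
  apply: le_lt_trans; rewrite le_eqVlt; apply/orP; left; apply/eqP.
  by apply: eq_integral => x _ /=; rewrite ger0_norm// sqr_ge0.
rewrite inE; apply/andP; split; rewrite inE//=.
rewrite /finite_norm unlock /= poweR_lty//.
apply: le_lt_trans f2; rewrite le_eqVlt; apply/orP; left; apply/eqP.
by apply: eq_integral => x _ /=; rewrite powR_mulrn// real_normK// num_real.
Qed.

Lemma measurable_sqr f : measurable_fun setT f ->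
  measurable_fun setT (fun x => (f x ^+ 2)%:E : \bar R).
Proof. by move=> mf; apply/measurable_EFinP; exact: measurable_funX. Qed.

Lemma integral_sqrD_le f g : measurable_fun setT f -> measurable_fun setT g ->
  (\int[mu]_x ((f x + g x) ^+ 2)%:E <=
   2%:E * \int[mu]_x (f x ^+ 2)%:E + 2%:E * \int[mu]_x (g x ^+ 2)%:E)%E.
Proof.
move=> mf mg.
have msf := measurable_sqr mf; have msg := measurable_sqr mg.
have sq0 h : forall x : T, setT x -> (0 <= (h x ^+ 2)%:E :> \bar R)%E.
  by move=> x _; rewrite lee_fin sqr_ge0.
have dbl (h : T -> R) : measurable_fun setT h ->
    (2%:E * \int[mu]_x (h x ^+ 2)%:E = \int[mu]_x (2%:E * (h x ^+ 2)%:E))%E.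
  move=> mh; rewrite ge0_integralZl_EFin//; [exact: sq0|exact: measurable_sqr].
rewrite !dbl// -ge0_integralD//; first last.
- exact: measurable_funeM.
- by move=> x _; rewrite mule_ge0// lee_fin sqr_ge0.
- exact: measurable_funeM.
- by move=> x _; rewrite mule_ge0// lee_fin sqr_ge0.
apply: ge0_le_integral => //.
- exact: sq0.
- by apply: measurable_sqr; exact: measurable_funD.
- by apply: emeasurable_funD; exact: measurable_funeM.
- move=> x _; rewrite -!EFinM -EFinD lee_fin.
  by have := sqr_ge0 (f x - g x); rewrite !expr2; lra.
Qed.

Section completeness.
Variable f : nat -> T -> R.
Hypothesis f2 : forall n, f n \in Lfun mu 2%:E.
Let mf n : measurable_fun setT (f n). Proof. by have [] := (Lfun2P (f n)).1 (f2 n). Qed.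

Let mfB m n : measurable_fun setT (fun x => f m x - f n x).
Proof. exact: measurable_funB. Qed.

(* The weights [4 ^ k] make [\sum_k 4 ^ k d_k ^ 2] integrable while its pointwise
   finiteness still forces geometric decay of the increments [d_k]. *)
Lemma fast_subsequence_cvg (h : nat -> nat) :
  (forall k, (\int[mu]_x ((f (h k.+1) x - f (h k) x) ^+ 2)%:E <= (8^-1 ^+ k)%:E)%E) ->
  exists D, [/\ measurable D, mu (~` D) = 0
    & forall x, D x -> cvgn (fun k => f (h k) x)].
Proof.
move=> h8; pose dk k x := f (h k.+1) x - f (h k) x.
pose F k x := (4 ^+ k * dk k x ^+ 2)%:E : \bar R.
have mF k : measurable_fun setT (F k).
  apply/measurable_EFinP; apply: measurable_funM => //.
  by apply: measurable_funX; exact: mfB.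
have F0 k x : (0 <= F k x)%E by rewrite lee_fin mulr_ge0 ?sqr_ge0 ?exprn_ge0.
pose G x := (\sum_(0 <= k <oo) F k x)%E.
have mG : measurable_fun setT G.
  by apply: ge0_emeasurable_sum.
have G0 x : (0 <= G x)%E by apply: nneseries_ge0 => k _ _; exact: F0.
have Gint : mu.-integrable setT G.
  apply/integrableP; split => //.
  under eq_integral do rewrite gee0_abs//.
  rewrite integral_nneseries//.
  apply: (@le_lt_trans _ _ (\sum_(0 <= k <oo) (2^-1 ^+ k)%:E)%E).
    apply: lee_nneseries => [k _ _|k _]; first exact: integral_ge0.
    under eq_integral do rewrite /F EFinM.
    rewrite ge0_integralZl_EFin//; last 2 first.
    - by move=> x _; rewrite lee_fin sqr_ge0.
    - exact: (measurable_sqr (mfB _ _)).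
    rewrite (_ : 2^-1 ^+ k = 4 ^+ k * 8^-1 ^+ k) ?EFinM.
      by apply: lee_wpmul2l; [rewrite lee_fin exprn_ge0|exact: h8].
    by rewrite -exprMn; congr (_ ^+ _); field.
  rewrite (@nneseries_psum _ (fun k => 2^-1 ^+ k) 2) ?ltry//.
  have := @cvg_geometric_series R 1 2^-1; rewrite ger0_norm ?invr_ge0//.
  rewrite invf_lt1 ?ltr1n// => /(_ isT).
  rewrite (_ : 1 / _ = 2); last by field.
  rewrite /series/=; under eq_fun do rewrite big_mkord.
  by under eq_fun do under eq_bigr do rewrite mul1r.
have [N [mN N0 GN]] := integrable_ae measurableT Gint.
exists (~` N); split; [exact: measurableC|by rewrite setCK|].
move=> x Nx.
have Gfin : G x \is a fin_num by apply: contrapT => Gx; apply: Nx; apply: GN => /(_ I).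
have dG k : `|dk k x| <= Num.sqrt (fine (G x)) * 2^-1 ^+ k.
  rewrite -(ler_pXn2r (_ : (0 < 2)%N))// ?nnegrE ?mulr_ge0 ?sqrtr_ge0 ?exprn_ge0 ?invr_ge0//.
  rewrite real_normK ?num_real// exprMn sqr_sqrtr ?fine_ge0//.
  rewrite -exprM mulnC exprM (_ : 2^-1 ^+ 2 = 4^-1); last by field.
  rewrite exprVn ler_pdivlMr ?exprn_gt0// mulrC -lee_fin fineK//.
  have := @nneseries_lim_ge R (F^~ x) xpredT 0 k.+1 (fun n _ _ => F0 n x).
  apply: le_trans; rewrite big_nat_recr//= leeDr//.
  exact: sume_ge0.
suff : cvgn (series (dk^~ x)).
  have -> : (fun k => f (h k) x) = (fun k => f (h 0) x + series (dk^~ x) k).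
    apply/funext => k; rewrite /series/=; elim: k => [|k IH].
      by rewrite big_geq// addr0.
    by rewrite big_nat_recr//= addrA -IH /dk addrC subrK.
  by move=> ds; apply: is_cvgD => //; exact: is_cvg_cst.
apply: normed_cvg; apply: series_le_cvg dG _ => //.
by apply: is_cvg_geometric_series; rewrite ger0_norm ?invr_ge0// invf_lt1 ?ltr1n.
Qed.

(** Riesz-Fischer: a fast subsequence converges almost everywhere, and Fatou's lemma turns the
    pointwise limit into a limit in norm of the whole sequence. *)
Lemma L2_complete :
  (forall eps : R, 0 < eps -> exists n0, forall m n, (n0 <= n)%N -> (n <= m)%N ->
    (\int[mu]_x ((f m x - f n x) ^+ 2)%:E <= eps%:E)%E) ->
  exists2 g, g \in Lfun mu 2%:E & forall eps : R, 0 < eps -> exists n0, forall n,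
    (n0 <= n)%N -> (\int[mu]_x ((f n x - g x) ^+ 2)%:E <= eps%:E)%E.
Proof.
move=> fC.
have /choice[N NP] : forall k, exists N, forall m n, (N <= n)%N -> (n <= m)%N ->
    (\int[mu]_x ((f m x - f n x) ^+ 2)%:E <= (8^-1 ^+ k)%:E)%E.
  by move=> k; apply: fC; rewrite exprn_gt0// invr_gt0.
(* This choice is monotone in [k] and dominates both [N k], for fast decay, and [k], to reach large
   indices. *)
pose h k := (k + \sum_(i < k.+1) N i)%N.
have hN k : (N k <= h k)%N by rewrite /h big_ord_recr/= addnA leq_addl.
have hS k : (h k <= h k.+1)%N.
  by rewrite /h leq_add// [leqRHS]big_ord_recr/= leq_addr.
have hk k : (k <= h k)%N by rewrite leq_addr.
have [D [mD D0 Dcvg]] := fast_subsequence_cvg (fun k => NP k _ _ (hN k) (hS k)).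
(* Cutting off outside [D] makes the subsequence converge everywhere, so its limit is measurable. *)
pose F k x := f (h k) x * \1_D x.
have mF k : measurable_fun setT (F k).
  by apply: measurable_funM => //; exact: measurable_indic.
pose g x := limn (F ^~ x).
have Fg x : F k x @[k --> \oo] --> g x.
  have [Dx|Dx] := pselect (D x).
    suff : cvgn (F^~ x) by [].
    rewrite /F indicE mem_set//.
    by under eq_fun do rewrite mulr1; exact: Dcvg.
  suff : cvgn (F^~ x) by [].
  rewrite /F indicE memNset//.
  by under eq_fun do rewrite mulr0; exact: is_cvg_cst.
have mg : measurable_fun setT g.
  by apply: (measurable_fun_cvg mF) => x _; exact: Fg.
have fF n k : (\int[mu]_x ((f n x - F k x) ^+ 2)%:E =
    \int[mu]_x ((f (h k) x - f n x) ^+ 2)%:E)%E.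
  apply: ge0_ae_eq_integral => //.
  - by apply: measurable_sqr; exact: measurable_funB.
  - by apply: measurable_sqr; exact: mfB.
  - by move=> x _; rewrite lee_fin sqr_ge0.
  - by move=> x _; rewrite lee_fin sqr_ge0.
  exists (~` D); split => //; first exact: measurableC.
  move=> x /=; apply: contra_not => Dx _.
  by rewrite /F indicE mem_set// mulr1; congr EFin; ring.
(* Fatou in [k]: the integrals for [F k] equal those for [f (h k)] and are at most [eps] once
   [k >= n]. *)
have close eps n0 n : (forall m n, (n0 <= n)%N -> (n <= m)%N ->
      (\int[mu]_x ((f m x - f n x) ^+ 2)%:E <= eps%:E)%E) -> (n0 <= n)%N ->
    (\int[mu]_x ((f n x - g x) ^+ 2)%:E <= eps%:E)%E.
  move=> n0P n0n; pose u k x := ((f n x - F k x) ^+ 2)%:E.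
  have ug x : u k x @[k --> \oo] --> ((f n x - g x) ^+ 2)%:E.
    apply/cvg_EFin; first exact: nearW.
    rewrite /u /comp/=; under eq_fun do rewrite expr2; rewrite expr2.
    by apply: cvgM; apply: cvgB => //; exact: cvg_cst.
  under eq_integral => x _ do rewrite -(cvg_limn_einf_sup (ug x)).1.
  apply: le_trans.
    apply: fatou => //.
    - move=> k; apply: measurable_sqr; exact: measurable_funB.
    - by move=> k x _; rewrite lee_fin sqr_ge0.
  rewrite limn_einf_lim; apply: lime_le; first exact: is_cvg_einfs.
  near=> k; apply: ereal_inf_le; exists (\int[mu]_x u k x)%E; first by exists k => /=.
  rewrite fF; apply: n0P => //; apply: leq_trans (hk k).
  by near: k; exists n.
exists g.
  apply/Lfun2P; split=> //.
  have [n0 n0P] := fC 1 ltr01.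
  have -> : (fun x => (g x ^+ 2)%:E) =
      (fun x => ((f n0 x + (g x - f n0 x)) ^+ 2)%:E) :> (T -> \bar R).
    by apply/funext => x; rewrite addrC subrK.
  apply: le_lt_trans (integral_sqrD_le (mf n0) _) _; first exact: measurable_funB.
  rewrite lte_add_pinfty// lte_mul_pinfty//.
  - by have [] := (Lfun2P (f n0)).1 (f2 n0).
  - apply: (@le_lt_trans _ _ 1%E); last exact: ltry.
    under eq_integral do rewrite -opprB sqrrN.
    exact: close n0P (leqnn _).
move=> eps /fC[n0 n0P]; exists n0 => n; exact: close.
Unshelve. all: by end_near. Qed.

End completeness.
End square_integrable.

(** * Translation invariance of Lebesgue measure on R^n *)

Section translation_invariance.
Variable R : realType.

(** The image measure agrees with Lebesgue measure on half-open intervals, which determine it. *)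
Lemma lebesgue_measure_translation (a : R) (A : set (measurableTypeR R)) :
  measurable A ->
  @lebesgue_measure R ((fun x : R => x + a) @^-1` A) = lebesgue_measure A.
Proof.
have ma : measurable_fun [set: measurableTypeR R]
    ((fun x => x + a) : measurableTypeR R -> measurableTypeR R).
  exact: measurable_funD.
pose m mf : {measure set (measurableTypeR R) -> \bar R} :=
  measure_function_pushforward__canonical__measure_function_Measure
    (@lebesgue_measure R)
    (f := (fun x => x + a) : measurableTypeR R -> measurableTypeR R) mf.
move=> mA; rewrite (@lebesgue_measure_unique R (m ma) _ A mA)// => X [[x y] _ <-] /=.
rewrite /m /= /pushforward.
rewrite (_ : _ @^-1` _ = [set` `]x - a, y - a]]); last first.
  by apply/seteqP; split=> z /=; rewrite !in_itv/= => /andP[? ?]; apply/andP; split; lra.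
rewrite !lebesgue_measure_itv/= !lte_fin ltrD2r; case: ifP => // _.
by rewrite -!EFinB; congr EFin; ring.
Qed.

Lemma measurable_translation n (v : 'rV[R]_n) :
  measurable_fun [set: 'rV[R]_n] (fun x => x + v).
Proof.
apply: measurable_fun_rVP => i; under eq_fun do rewrite mxE.
by apply: measurable_funD => //; exact: measurable_coord.
Qed.

(** Induction along the product: the sections are translated by the induction hypothesis, the first
    coordinate by the one-dimensional case. *)
Lemma lebesgue_rV_translation n (v : 'rV[R]_n) (A : set 'rV[R]_n) :
  measurable A -> lebesgue_rV R n ((fun x => x + v) @^-1` A) = lebesgue_rV R n A.
Proof.
elim: n v A => [|n IH] v A mA.
  by congr (lebesgue_rV _ _ _); apply/seteqP; split=> x /=; rewrite !thinmx0.
rewrite /= /lebesgue_step /pushforward.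
set B := rV_cons (n:=n) @^-1` A.
have mB : measurable B.
  by rewrite -[X in measurable X]setTI; exact: measurable_rV_cons.
pose v0 := v ord0 ord0; pose v' := \row_i v ord0 (lift ord0 i).
pose phi x := lebesgue_rV R n (xsection B x).
have mphi : measurable_fun [set: measurableTypeR R] phi.
  exact: measurable_fun_xsection.
have phi0 x : (0 <= phi x)%E by exact: measure_ge0.
rewrite /product_measure1.
transitivity (\int[@lebesgue_measure R]_x phi ((x : R) + v0)%R)%E.
  apply: eq_integral => x _ /=; have mBx := measurable_xsection ((x : R) + v0) mB.
  rewrite /phi -(IH v' _ mBx).
  congr (lebesgue_rV _ _ _); apply/seteqP; split=> w; rewrite /xsection/= !inE /B/=;
    rewrite (_ : rV_cons (x, w) + v = rV_cons (x + v0, w + v'))//;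
    by apply/rowP => i; rewrite mxE; case: (unliftP ord0 i) => [j ->|->];
     rewrite ?rV_consS ?rV_cons0//= !mxE.
have ma : measurable_fun [set: measurableTypeR R]
    ((fun x => x + v0) : measurableTypeR R -> measurableTypeR R).
  exact: measurable_funD.
transitivity (\int[pushforward (@lebesgue_measure R)
    ((fun x => x + v0)%R : measurableTypeR R -> measurableTypeR R)]_x phi x)%E.
  by rewrite ge0_integral_pushforward// preimage_setT.
apply: eq_measure_integral => X mX _.
exact: lebesgue_measure_translation.
Qed.

Lemma ge0_integral_translation n (v : 'rV[R]_n) (f : 'rV[R]_n -> \bar R) :
  measurable_fun setT f -> (forall x, 0 <= f x)%E ->
  (\int[lebesgue_rV R n]_x f (x + v)%R = \int[lebesgue_rV R n]_x f x)%E.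
Proof.
move=> mf f0.
have mv := measurable_translation v.
transitivity (\int[pushforward (lebesgue_rV R n) (fun x => x + v)%R]_x f x)%E.
  by rewrite ge0_integral_pushforward// preimage_setT.
apply: eq_measure_integral => X mX _.
exact: lebesgue_rV_translation.
Qed.

End translation_invariance.

Section real_inner_product.
Context d (T : measurableType d) (R : realType).
Variable mu : {measure set T -> \bar R}.
Implicit Types u v w : T -> R.
Local Notation L2r := (Lfun mu 2%:E).

Definition rip u v : R := \int[mu]_x (u x * v x).

Lemma integrable_mul2 u v : u \in L2r -> v \in L2r ->
  mu.-integrable setT (EFin \o (fun x => u x * v x)).
Proof. by move=> u2 v2; apply/Lfun1_integrable; exact: Lfun2_mul_Lfun1. Qed.

Lemma ripC u v : rip u v = rip v u.
Proof. by apply: eq_Rintegral => x _; rewrite mulrC. Qed.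

Lemma Lfun2D u v : u \in L2r -> v \in L2r -> (fun x => u x + v x) \in L2r.
Proof.
move=> /Lfun2P[mu_ u2] /Lfun2P[mv v2]; apply/Lfun2P; split.
  exact: measurable_funD.
rewrite /=; apply: (le_lt_trans (integral_sqrD_le mu mu_ mv)).
by rewrite lte_add_pinfty// lte_mul_pinfty.
Qed.

Lemma Lfun2Z (a : R) u : u \in L2r -> (fun x => a * u x) \in L2r.
Proof.
move=> u2; rewrite (_ : (fun x => _) = a \o* u).
  by apply: Lfun_scale => //; rewrite ler1n.
by apply/funext => x /=; rewrite mulrC.
Qed.

Lemma Lfun20 : (fun=> 0 : R) \in L2r.
Proof.
apply/Lfun2P; split; first exact: measurable_cst.
by under eq_integral do rewrite expr0n/=; rewrite integral0 ltry.
Qed.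

Lemma ripD u v w : u \in L2r -> v \in L2r -> w \in L2r ->
  rip (fun x => u x + v x) w = rip u w + rip v w.
Proof.
move=> u2 v2 w2; rewrite /rip -RintegralD//; try exact: integrable_mul2.
by apply: eq_Rintegral => x _; rewrite mulrDl.
Qed.

Lemma ripZ a u w : u \in L2r -> w \in L2r ->
  rip (fun x => a * u x) w = a * rip u w.
Proof.
move=> u2 w2; rewrite /rip -RintegralZl//; last exact: integrable_mul2.
by apply: eq_Rintegral => x _; rewrite mulrA.
Qed.

Lemma rip_ge0 u : 0 <= rip u u.
Proof. by apply: Rintegral_ge0 => x _; rewrite -expr2 sqr_ge0. Qed.

Lemma rip_integral u : u \in L2r ->
  (rip u u)%:E = (\int[mu]_x (u x ^+ 2)%:E)%E.
Proof.
move=> /Lfun2P[mu_ u2]; rewrite /rip /Rintegral fineK//.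
under eq_integral do rewrite -expr2.
by rewrite ge0_fin_numE// integral_ge0// => x _; rewrite lee_fin sqr_ge0.
Qed.

Lemma rip_eq0 u : u \in L2r -> rip u u = 0 <-> ae_eq mu setT u (cst 0).
Proof.
move=> u2; have [mu_ _] := (Lfun2P mu u).1 u2.
have ms : measurable_fun [set: T] (fun x => (u x ^+ 2)%:E : \bar R).
  exact: measurable_sqr.
have := @ae_eq_integral_abs _ _ _ mu _ measurableT _ ms.
have -> : (\int[mu]_x `|(u x ^+ 2)%:E| = (rip u u)%:E)%E.
  rewrite rip_integral//; apply: eq_integral => x _.
  by rewrite gee0_abs// lee_fin sqr_ge0.
move=> [h1 h2]; split=> [u0|u0].
  have := h1 (congr1 EFin u0); apply: filterS => x /(_ I) [/eqP].
  by rewrite sqrf_eq0 => /eqP.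
apply: EFin_inj; apply: h2; move: u0; apply: filterS => x /(_ I) /= -> _.
by rewrite expr0n.
Qed.

End real_inner_product.

(** * L^2(R^d) as an instance of [hilbert] *)

Section L2_space.
Variables (R : realType) (d : nat).
Local Notation C := R[i].
Local Notation Rd := 'rV[R]_d.
Local Notation mu := (lebesgue_rV R d).
Local Notation L2r := (Lfun mu 2%:E).
Local Notation Re := complex.Re.
Local Notation Im := complex.Im.
Implicit Types f g h : Rd -> C.

Let re f : Rd -> R := fun t => Re (f t).
Let im f : Rd -> R := fun t => Im (f t).

Lemma innerE f g : L2 f -> L2 g ->
  inner f g = (rip mu (re f) (re g) + rip mu (im f) (im g)) +i*
              (rip mu (im f) (re g) - rip mu (re f) (im g)).
Proof.
move=> [fr fi] [gr gi]; rewrite /inner /Cintegral; congr (_ +i* _).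
  rewrite /rip -RintegralD//; try exact: integrable_mul2.
  by apply: eq_Rintegral => x _; rewrite /re /im !partsE; ring.
rewrite /rip -RintegralB//; try exact: integrable_mul2.
by apply: eq_Rintegral => x _; rewrite /re /im !partsE; ring.
Qed.

Lemma L2_linear (a : C) f g : L2 f -> L2 g -> L2 (fun t => a * f t + g t).
Proof.
move=> [fr fi] [gr gi]; split.
  rewrite (_ : (fun t => _) =
    (fun t => (Re a * re f t + (- Im a) * im f t) + re g t)).
    by do 2 (apply: Lfun2D => //); exact: Lfun2Z.
  by apply/funext => t; rewrite /re /im !partsE mulNr.
rewrite (_ : (fun t => _) = (fun t => (Re a * im f t + Im a * re f t) + im g t)).
  by do 2 (apply: Lfun2D => //); exact: Lfun2Z.
by apply/funext => t; rewrite /re /im !partsE.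
Qed.

Lemma L2_0 : L2 (fun=> 0 : C) (R := R) (d := d).
Proof. by split; exact: Lfun20. Qed.

Definition L2fun := {f : Rd -> C | L2 f}.

HB.instance Definition _ := gen_eqMixin L2fun.
HB.instance Definition _ := gen_choiceMixin L2fun.

Implicit Types u v w : L2fun.

(** Addition, scaling and opposite are all instances of this operation, so that one closure property
    supports the whole module structure. *)
Definition L2lin (a : C) u v : L2fun :=
  exist _ _ (L2_linear a (svalP u) (svalP v)).
Definition L2zero : L2fun := exist _ _ L2_0.
Definition L2add u v := L2lin 1 u v.
Definition L2scale a u := L2lin a u L2zero.
Definition L2opp u := L2scale (-1) u.

Lemma L2funP u v : (forall t, sval u t = sval v t) -> u = v.
Proof.
case: u v => [f pf] [g pg] /= fg.
have {}fg : f = g by exact/funext.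
by rewrite fg in pf *; congr exist; exact: Prop_irrelevance.
Qed.

Fact L2addA : associative L2add.
Proof. by move=> u v w; apply: L2funP => t /=; ring. Qed.
Fact L2addC : commutative L2add.
Proof. by move=> u v; apply: L2funP => t /=; ring. Qed.
Fact L2add0 : left_id L2zero L2add.
Proof. by move=> u; apply: L2funP => t /=; ring. Qed.
Fact L2addN : left_inverse L2zero L2opp L2add.
Proof. by move=> u; apply: L2funP => t /=; ring. Qed.

HB.instance Definition _ := GRing.isZmodule.Build L2fun L2addA L2addC L2add0 L2addN.

Fact L2scaleA a b u : L2scale a (L2scale b u) = L2scale (a * b) u.
Proof. by apply: L2funP => t /=; ring. Qed.
Fact L2scale1 : left_id 1 L2scale.
Proof. by move=> u; apply: L2funP => t /=; ring. Qed.
Fact L2scaleDr : right_distributive L2scale +%R.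
Proof. by move=> a u v; apply: L2funP => t /=; ring. Qed.
Fact L2scaleDl u : {morph L2scale^~ u : a b / a + b}.
Proof. by move=> a b; apply: L2funP => t /=; ring. Qed.

HB.instance Definition _ := GRing.Zmodule_isLmodule.Build C L2fun
  L2scaleA L2scale1 L2scaleDr L2scaleDl.

Lemma sval_linear a u v t : sval (a *: u + v) t = a * sval u t + sval v t.
Proof. by rewrite /=; ring. Qed.

Lemma sval_sub u v t : sval (u - v) t = sval u t - sval v t.
Proof. by rewrite /=; ring. Qed.

Definition L2ip u v : C := inner (sval u) (sval v).

Fact L2ip_sip : semi_inner_product L2ip.
Proof.
split=> [a [f f2] [g g2] [h h2]|[f f2] [g g2]|[f f2]]; rewrite /L2ip.
- rewrite (_ : sval _ = (fun t => a * f t + g t)); last first.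
    by apply/funext => t; rewrite sval_linear.
  have f2' := f2; have g2' := g2; have h2' := h2.
  rewrite !innerE//; last exact: L2_linear.
  move: f2 g2 h2 => [fr fi] [gr gi] [hr hi].
  have -> : re (fun t => a * f t + g t) =
     (fun t => (Re a * re f t + (- Im a) * im f t) + re g t).
    by apply/funext => t; rewrite /re /im !partsE mulNr.
  have -> : im (fun t => a * f t + g t) =
     (fun t => (Re a * im f t + Im a * re f t) + im g t).
    by apply/funext => t; rewrite /re /im !partsE.
  have rA b c p q r s : p \in L2r -> q \in L2r -> r \in L2r -> s \in L2r ->
     rip mu (fun t => b * p t + c * q t + r t) s =
     b * rip mu p s + c * rip mu q s + rip mu r s.
    move=> p2 q2 r2 s2; rewrite !ripD ?ripZ//; try exact: Lfun2Z.
    by apply: Lfun2D; exact: Lfun2Z.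
  rewrite !rA//; apply: complexP; rewrite !(ReP, ImP, partsE); ring.
- by rewrite !innerE// (ripC mu (re g)) (ripC mu (im g)) (ripC mu (im g) (re f))
    (ripC mu (re g) (im f)); apply: complexP; rewrite !(ReP, ImP, partsE); ring.
- by rewrite innerE//= addr_ge0 ?rip_ge0.
Qed.

Lemma L2ip_sub u v : (Re (L2ip (u - v) (u - v)))%:E =
  (\int[mu]_x ((re (sval u) x - re (sval v) x) ^+ 2)%:E +
   \int[mu]_x ((im (sval u) x - im (sval v) x) ^+ 2)%:E)%E.
Proof.
have uv2 := svalP (u - v); have [r2 i2] := uv2.
rewrite /L2ip innerE// ReP.
rewrite EFinD !rip_integral//; congr (_ + _)%E; apply: eq_integral => x _;
  by rewrite /re /im sval_sub !partsE.
Qed.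

Fact L2ip_complete (u : nat -> L2fun) :
  (forall eps : R, 0 < eps -> exists n0, forall m n, (n0 <= n)%N ->
     (n <= m)%N -> Re (L2ip (u m - u n) (u m - u n)) <= eps) ->
  exists w, Re (L2ip (u n - w) (u n - w)) @[n --> \oo] --> 0.
Proof.
move=> uC.
have int0 (v : Rd -> R) : (0 <= \int[mu]_x (v x ^+ 2)%:E)%E.
  by apply: integral_ge0 => x _; rewrite lee_fin sqr_ge0.
have [gr gr2 grP] : exists2 g, g \in L2r & forall eps : R, 0 < eps -> exists n0,
    forall n, (n0 <= n)%N ->
    (\int[mu]_x ((re (sval (u n)) x - g x) ^+ 2)%:E <= eps%:E)%E.
  apply: L2_complete => [n|eps e0]; first by case: (svalP (u n)).
  have [n0 n0P] := uC eps e0; exists n0 => m n n0n nm.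
  by have := n0P m n n0n nm; rewrite -lee_fin L2ip_sub; apply: le_trans; rewrite leeDl.
have [gi gi2 giP] : exists2 g, g \in L2r & forall eps : R, 0 < eps -> exists n0,
    forall n, (n0 <= n)%N ->
    (\int[mu]_x ((im (sval (u n)) x - g x) ^+ 2)%:E <= eps%:E)%E.
  apply: L2_complete => [n|eps e0]; first by case: (svalP (u n)).
  have [n0 n0P] := uC eps e0; exists n0 => m n n0n nm.
  by have := n0P m n n0n nm; rewrite -lee_fin L2ip_sub; apply: le_trans; rewrite leeDr.
have g2 : L2 (fun t => gr t +i* gi t) by [].
exists (exist _ _ g2); apply/cvgrPdist_le => eps e0.
have e2 : 0 < eps / 2 by rewrite divr_gt0.
have [n0 n0P] := grP _ e2; have [n1 n1P] := giP _ e2.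
near=> n.
have /andP[/n0P h0 /n1P h1] : (n0 <= n)%N && (n1 <= n)%N.
  by rewrite -geq_max; near: n; exists (maxn n0 n1).
rewrite sub0r normrN ger0_norm; last exact: (sip_ge0 L2ip_sip).
rewrite -lee_fin L2ip_sub (splitr eps) EFinD.
exact: leeD.
Unshelve. all: by end_near. Qed.

Definition L2hilbert : hilbert R := Hilbert L2ip_sip L2ip_complete.

Definition toL2 f (f2 : L2 f) : L2hilbert := exist _ f f2.

(** The dictionary between almost everywhere equality and the abstract theory, where equality is
    distance 0. *)
Lemma eqL2_nsq u v : eqL2 (sval u) (sval v) <-> nsq (u - v : L2hilbert) = 0.
Proof.
have uv2 := svalP (u - v); have [r2 i2] := uv2.
rewrite /nsq [ip _ _]innerE// ReP.
have rE t : re (sval (u - v)) t = re (sval u) t - re (sval v) t.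
  by rewrite /re sval_sub !partsE.
have iE t : im (sval (u - v)) t = im (sval u) t - im (sval v) t.
  by rewrite /im sval_sub !partsE.
split=> [uv|/eqP].
  rewrite (rip_eq0 r2).2 ?(rip_eq0 i2).2 ?addr0//; move: uv; apply: filterS;
    move=> t /(_ I) h _; [apply: etrans (iE t) _|apply: etrans (rE t) _];
    by rewrite /re /im/= h subrr.
rewrite paddr_eq0 ?rip_ge0// => /andP[/eqP/(rip_eq0 r2)+ /eqP/(rip_eq0 i2)].
apply: filterS2 => t /(_ I) hr /(_ I) hi _; apply: complexP; apply/subr0_eq.
  by rewrite -[LHS]rE.
by rewrite -[LHS]iE.
Qed.

End L2_space.

(** * Bounded operators and time-frequency shifts *)

Section operators.
Variables (R : realType) (d : nat).
Local Notation C := R[i].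
Local Notation H := (L2hilbert R d).
Local Notation Re := complex.Re.
Local Notation Im := complex.Im.
Local Notation sip := (ip_sip H).
Local Notation nsq := (@nsq R H).
Implicit Types (u v w : H) (T : operator R d) (K : H -> H).

Lemma ip_nsq0 u v w : nsq (u - v) = 0 -> ip u w = ip v w.
Proof. by move=> uv; apply/subr0_eq; rewrite -(sipBl sip) (sip_null sip). Qed.

Lemma nsq0_ip u v : (forall w, ip u w = ip v w) -> nsq (u - v) = 0.
Proof. by move=> uv; rewrite /nsq (sipBl sip) uv subrr. Qed.

(** [opfun] and [ofun] pass between operators on functions and maps of [H]. The default values are
    not reached for a bounded operator, respectively for a square-integrable argument. *)
Definition opfun T u : H :=
  if pselect (L2 (T (sval u))) is left h then toL2 h else 0.

Definition ofun K : operator R d := fun f =>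
  if pselect (L2 f) is left h then sval (K (toL2 h)) else cst 0.

Lemma opfunE T u : bounded_operator T -> sval (opfun T u) = T (sval u).
Proof.
by move=> [TL2 _ _]; rewrite /opfun; case: pselect => // h; case: h; exact/TL2/svalP.
Qed.

Lemma ofunE K f (f2 : L2 f) : ofun K f = sval (K (toL2 f2)).
Proof. by rewrite /ofun; case: pselect => // h; congr (sval (K _)); exact: L2funP. Qed.

Lemma normL2E u : normL2 (sval u) = Num.sqrt (nsq u).
Proof. by []. Qed.

Lemma opfun_bounded T : bounded_operator T ->
  exists2 c : R, 0 <= c & forall u, nsq (opfun T u) <= c * nsq u.
Proof.
move=> Tb; have [_ _ [M TM]] := Tb; exists (M ^+ 2); first exact: sqr_ge0.
move=> u; have := TM _ (svalP u); rewrite -(opfunE u Tb) !normL2E => h.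
have h0 : 0 <= M * Num.sqrt (nsq u) by apply: le_trans h; exact: sqrtr_ge0.
rewrite -(sqr_sqrtr (nsq_ge0 (opfun T u))) -(sqr_sqrtr (nsq_ge0 u)) -exprMn.
by rewrite ler_pXn2r// nnegrE sqrtr_ge0.
Qed.

Lemma opfun_bounded_form T : bounded_operator T -> bounded_form (opfun T).
Proof.
(* [c + 1] dominates the square root of [c], the constant that Cauchy-Schwarz would give. *)
move=> /opfun_bounded[c c0 Tc]; exists (c + 1) => u; have u0 := nsq_ge0 u.
have h : quad (opfun T) u ^+ 2 <= c * nsq u * nsq u.
  apply: le_trans (Re_sqr_le _) _; apply: le_trans (ip_le _ _) _.
  by rewrite ler_wpM2r.
apply: le_trans (ler_norm _) _.
rewrite -(ler_pXn2r (_ : (0 < 2)%N))// ?nnegrE ?mulr_ge0 ?addr_ge0//.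
by rewrite real_normK ?num_real// (le_trans h)// !expr2; nra.
Qed.

Lemma opfun_linear T a u v w : bounded_operator T ->
  ip (opfun T (a *: u + v)) w = a * ip (opfun T u) w + ip (opfun T v) w.
Proof.
move=> Tb; rewrite -(sip_linear sip); apply: ip_nsq0; apply/eqL2_nsq.
have [_ Tl _] := Tb; have := Tl a _ _ (svalP u) (svalP v).
rewrite opfunE// (_ : sval (a *: u + v : H) = fun t => a * sval u t + sval v t); last first.
  by apply/funext => t; exact: sval_linear.
rewrite (_ : sval (a *: opfun T u + opfun T v : H) = fun t => a * T (sval u) t + T (sval v) t)//.
by apply/funext => t; rewrite [LHS]sval_linear !opfunE.
Qed.

Lemma ofun_bounded_operator K (c : R) :
  (forall a u v w, ip (K (a *: u + v)) w = a * ip (K u) w + ip (K v) w) ->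
  (forall u, nsq (K u) <= c * nsq u) -> bounded_operator (ofun K).
Proof.
move=> Kl Kc; split=> [f f2|a f g f2 g2|].
- by rewrite (ofunE _ f2); exact: svalP.
- have fg2 : L2 (fun t => a * f t + g t) by exact: L2_linear.
  rewrite (ofunE _ f2) (ofunE _ g2) (ofunE _ fg2).
  rewrite [X in eqL2 _ X](_ : _ = sval (a *: K (toL2 f2) + K (toL2 g2) : H)); last first.
    by apply/funext => t; rewrite [RHS]sval_linear.
  apply/eqL2_nsq/nsq0_ip => w; rewrite (sip_linear sip) -Kl; congr (ip (K _) w).
  by apply: L2funP => t; rewrite [RHS]sval_linear.
- exists (Num.sqrt c) => f f2; rewrite (ofunE _ f2) !normL2E.
  have [c0|c0] := leP 0 c.
    by rewrite -[normL2 f]/(Num.sqrt (nsq (toL2 f2))) -sqrtrM// ler_wsqrtr.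
  (* For [c < 0] the square root is 0 by convention, and the bound on [K] forces all its values to
     be null. *)
  rewrite (ltr0_sqrtr c0) mul0r (_ : nsq _ = 0) ?sqrtr0//.
  apply/eqP; rewrite eq_le nsq_ge0 andbT (le_trans (Kc _))//.
  by rewrite mulr_le0_ge0// ?nsq_ge0// ltW.
Qed.

Lemma ip_quad4 T u v : bounded_operator T ->
  forall a : C, ip (opfun T (a *: u + v)) (a *: u + v) =
   a * a^* * ip (opfun T u) u + a * ip (opfun T u) v +
   a^* * ip (opfun T v) u + ip (opfun T v) v.
Proof.
move=> Tb a; rewrite opfun_linear// !(sipDr sip) !(sipZr sip); ring.
Qed.

(** Polarization: the quadratic form is real at [u + v] and at [i u + v], which yields the imaginary
    and the real part of the symmetry identity. *)
Lemma positive_opfun T : bounded_operator T -> positive_operator T ->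
  positive_symmetric (opfun T).
Proof.
move=> Tb Tp.
have pos u : 0 <= quad (opfun T) u /\ Im (ip (opfun T u) u) = 0.
  apply/complex_ge0; have := Tp _ (svalP u).
  by rewrite -(opfunE u Tb).
split=> [u v|u]; last exact: (pos u).1.
rewrite (sip_conj sip (opfun T v)).
have [_ u0] := pos u; have [_ v0] := pos v.
have [_] := pos (1 *: u + v); rewrite ip_quad4//.
have [i [ri ii]] : exists i : C, Re i = 0 /\ Im i = 1 by exists (0 +i* 1).
have [_] := pos (i *: u + v); rewrite ip_quad4//.
move: u0 v0; move: (ip _ u) (ip _ v) (ip (opfun T u) v) (ip (opfun T v) u).
move=> x y z w x0 y0; rewrite !partsE ri ii x0 y0 => h1 h2.
apply: complexP; rewrite !partsE; lra.
Qed.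

Section onb.
Variable e : nat -> H.
Hypothesis eo : onb e.

(** For each [u], Riesz represents the conjugate of [b u], which is linear. The bound on [K] comes
    from |K u|^4 = |b u (K u)|^2 <= c |u|^2 |K u|^2. *)
Lemma sesquilinear_operator (b : H -> H -> C) (c : R) : 0 <= c ->
  (forall a u v w, b (a *: u + v) w = a * b u w + b v w) ->
  (forall a u v w, b w (a *: u + v) = a^* * b w u + b w v) ->
  (forall u v, sqn (b u v) <= c * (nsq u * nsq v)) ->
  exists K, (forall u v, ip (K u) v = b u v) /\ bounded_operator (ofun K).
Proof.
move=> c0 bl br bc.
have /choice[K KP] : forall u, exists w, forall v, ip v w = (b u v)^*.
  move=> u; apply: (riesz (c := c * nsq u) eo) => [a v w|v].
    by rewrite br rmorphD rmorphM/= conjCK.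
  by rewrite sqnJ -mulrA.
have Kb u v : ip (K u) v = b u v by rewrite (sip_conj sip) KP conjCK.
exists K; split=> //; apply: (@ofun_bounded_operator _ c) => [a u v w|u].
  by rewrite !Kb.
have := bc u (K u); rewrite -Kb (sip_diag sip) sqnC -/(nsq _).
have [->|k0] := eqVneq (nsq (K u)) 0; first by rewrite mulr_ge0 ?nsq_ge0.
by rewrite mulrA expr2 ler_pM2r// lt_def k0 nsq_ge0.
Qed.

Lemma hermitian_operator (b : H -> H -> C) (c : R) : 0 <= c ->
  (forall a u v w, b (a *: u + v) w = a * b u w + b v w) ->
  (forall u v, b v u = (b u v)^*) ->
  (forall u v, sqn (b u v) <= c * (nsq u * nsq v)) ->
  exists K, (forall u v, ip (K u) v = b u v) /\ bounded_operator (ofun K).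
Proof.
move=> c0 bl bC; apply: sesquilinear_operator => // a u v w.
by rewrite (bC (a *: u + v)) bl rmorphD rmorphM/= -(bC u) -(bC v).
Qed.

(** This gives content to [adjoint], which is otherwise an arbitrary value. *)
Lemma adjoint_exists T : bounded_operator T -> exists T', is_adjoint T T'.
Proof.
move=> Tb; have [c c0 Tc] := opfun_bounded Tb.
have [a u v w|a u v w|u v|K [KP Kb]] :=
  @sesquilinear_operator (fun u v => ip u (opfun T v)) c c0.
- by rewrite (sip_linear sip).
- rewrite (sip_conj sip) opfun_linear// rmorphD rmorphM/=.
  by rewrite -!(sip_conj sip).
- by rewrite (le_trans (ip_le _ _))// mulrCA ler_wpM2l ?nsq_ge0.
exists (ofun K); split=> // f g f2 g2; rewrite (ofunE K g2).
have := KP (toL2 g2) (toL2 f2) => /(congr1 Num.conj).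
rewrite -!(sip_conj sip) => h.
by rewrite -[T f](opfunE (toL2 f2) Tb); exact/esym.
Qed.

Lemma adjointP T : bounded_operator T -> is_adjoint T (adjoint T).
Proof. by move=> /adjoint_exists [T' T'P]; apply: xgetPex; exists T'. Qed.

Lemma adjoint_opfun T u v : bounded_operator T ->
  ip (opfun T u) v = ip u (opfun (adjoint T) v).
Proof.
move=> Tb; have [Tb' TP] := adjointP Tb.
have := TP _ _ (svalP u) (svalP v).
by rewrite -(opfunE u Tb) -(opfunE v Tb').
Qed.

End onb.

Lemma onb_orthonormal_basis (e : nat -> 'rV[R]_d -> C) (eb : orthonormal_basis e) :
  exists E : nat -> H, onb E /\ forall n, sval (E n) = e n.
Proof.
have [e2 eo ec] := eb; exists (fun n => toL2 (e2 n)); split=> //.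
split=> [i j|u ue]; first exact: eo.
rewrite -[u]subr0; apply/eqL2_nsq; exact: ec (svalP u) ue.
Qed.

End operators.

(** * Time-frequency shifts: isometry and measurability *)

Section time_frequency_shifts.
Variables (R : realType) (d : nat).
Local Notation C := R[i].
Local Notation Rd := 'rV[R]_d.
Local Notation H := (L2hilbert R d).
Local Notation mu := (lebesgue_rV R d).
Local Notation Re := complex.Re.
Local Notation Im := complex.Im.
Local Notation sip := (ip_sip H).
Local Notation nsq := (@nsq R H).
Implicit Types (f g : Rd -> C) (u v w : H) (z : Rd * Rd).

Lemma L2_measurable f : L2 f ->
  measurable_fun setT (fun t => Re (f t)) /\ measurable_fun setT (fun t => Im (f t)).
Proof. by move=> [/Lfun2P[? _] /Lfun2P[? _]]. Qed.

Lemma measurable_sqn dT (T : measurableType dT) (f : T -> C) :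
  measurable_fun setT (fun t => Re (f t)) ->
  measurable_fun setT (fun t => Im (f t)) ->
  measurable_fun setT (fun t => (sqn (f t))%:E : \bar R).
Proof.
by move=> mr mi; apply/measurable_EFinP; apply: measurable_funD; exact: measurable_funX.
Qed.

Lemma integral_sqn f : measurable_fun setT (fun t => Re (f t)) ->
  measurable_fun setT (fun t => Im (f t)) ->
  (\int[mu]_t (sqn (f t))%:E =
   \int[mu]_t (Re (f t) ^+ 2)%:E + \int[mu]_t (Im (f t) ^+ 2)%:E)%E.
Proof.
move=> mr mi; rewrite -ge0_integralD//.
- by move=> t _; rewrite lee_fin sqr_ge0.
- exact: measurable_sqr.
- by move=> t _; rewrite lee_fin sqr_ge0.
- exact: measurable_sqr.
Qed.

Lemma L2P f : L2 f <-> [/\ measurable_fun setT (fun t => Re (f t)),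
  measurable_fun setT (fun t => Im (f t)) & (\int[mu]_t (sqn (f t))%:E < +oo)%E].
Proof.
have ge0 (h : Rd -> R) : (0 <= \int[mu]_t (h t ^+ 2)%:E)%E.
  by apply: integral_ge0 => t _; rewrite lee_fin sqr_ge0.
split=> [[/Lfun2P[mr r2] /Lfun2P[mi i2]]|[mr mi]].
  by split=> //; rewrite integral_sqn// lte_add_pinfty.
rewrite integral_sqn// => f2; split; apply/Lfun2P; split=> //.
  by apply: le_lt_trans f2; rewrite leeDl.
by apply: le_lt_trans f2; rewrite leeDr.
Qed.

Lemma nsq_integral u : (nsq u)%:E = (\int[mu]_t (sqn (sval u t))%:E)%E.
Proof.
have u2 := svalP u; have [ur ui] := u2; have [mr mi] := L2_measurable u2.
by rewrite integral_sqn// -!rip_integral// -EFinD /nsq [ip _ _]innerE.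
Qed.

Lemma tf_shift_linear z (a : C) f g t :
  tf_shift z (fun t => a * f t + g t) t = a * tf_shift z f t + tf_shift z g t.
Proof. by rewrite /tf_shift; ring. Qed.

Lemma sqn_tf_shift z f t : sqn (tf_shift z f t) = sqn (f (t - z.1)).
Proof.
rewrite /tf_shift sqnM [X in X * _](_ : _ = 1) ?mul1r//.
by rewrite /sqn !(ReP, ImP) cos2Dsin2.
Qed.

(** Joint measurability in the shift and the point makes the inner products below measurable
    functions of the shift. *)
Lemma measurable_tf_shift f : L2 f ->
  measurable_fun setT (fun p : (Rd * Rd) * Rd => Re (tf_shift p.1 f p.2)) /\
  measurable_fun setT (fun p : (Rd * Rd) * Rd => Im (tf_shift p.1 f p.2)).
Proof.
move=> /L2_measurable[mr mi].
have m11 : measurable_fun setT (fun p : (Rd * Rd) * Rd => p.1.1).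
  exact: measurableT_comp measurable_fst measurable_fst.
have m12 : measurable_fun setT (fun p : (Rd * Rd) * Rd => p.1.2).
  exact: measurableT_comp measurable_snd measurable_fst.
have m2 : measurable_fun setT (fun p : (Rd * Rd) * Rd => p.2).
  exact: measurable_snd.
have msub : measurable_fun setT (fun p : (Rd * Rd) * Rd => p.2 - p.1.1).
  apply: measurable_fun_rVP => i; under eq_fun do rewrite !mxE.
  apply: measurable_funB; apply: (measurableT_comp (measurable_coord i)) => //.
have mth : measurable_fun setT (fun p : (Rd * Rd) * Rd =>
    2 * pi * (\sum_(i < d) p.2 ord0 i * p.1.2 ord0 i)).
  apply: measurable_funM => //; apply: measurable_sum => i.
  by apply: measurable_funM; apply: (measurableT_comp (measurable_coord i)).
have mcos := measurableT_comp (continuous_measurable_fun (@continuous_cos R)) mth.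
have msin := measurableT_comp (continuous_measurable_fun (@continuous_sin R)) mth.
have mrs := measurableT_comp mr msub.
have mis := measurableT_comp mi msub.
split.
  rewrite (_ : (fun p => _) = (fun p : (Rd * Rd) * Rd =>
    cos (2 * pi * (\sum_(i < d) p.2 ord0 i * p.1.2 ord0 i)) * Re (f (p.2 - p.1.1))
    - sin (2 * pi * (\sum_(i < d) p.2 ord0 i * p.1.2 ord0 i)) * Im (f (p.2 - p.1.1)))).
    by apply: measurable_funB; apply: measurable_funM.
  by apply/funext => p; rewrite /tf_shift cReM.
rewrite (_ : (fun p => _) = (fun p : (Rd * Rd) * Rd =>
    cos (2 * pi * (\sum_(i < d) p.2 ord0 i * p.1.2 ord0 i)) * Im (f (p.2 - p.1.1))
    + sin (2 * pi * (\sum_(i < d) p.2 ord0 i * p.1.2 ord0 i)) * Re (f (p.2 - p.1.1)))).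
  by apply: measurable_funD; apply: measurable_funM.
by apply/funext => p; rewrite /tf_shift cImM.
Qed.

Lemma tf_shift_integral z f : L2 f ->
  (\int[mu]_t (sqn (tf_shift z f t))%:E = \int[mu]_t (sqn (f t))%:E)%E.
Proof.
move=> /L2_measurable[mr mi].
rewrite -[RHS](ge0_integral_translation (- z.1)).
- by apply: eq_integral => t _; rewrite sqn_tf_shift.
- exact: measurable_sqn.
- by move=> t; rewrite lee_fin sqn_ge0.
Qed.

Lemma tf_shift_L2 z f : L2 f -> L2 (tf_shift z f).
Proof.
move=> f2; have [mr mi] := measurable_tf_shift f2; apply/L2P; split.
- exact: (measurableT_comp mr (measurable_pair1 z)).
- exact: (measurableT_comp mi (measurable_pair1 z)).
- by rewrite tf_shift_integral//; have /L2P[] := f2.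
Qed.

Lemma nsq_tf_shift z f (f2 : L2 f) (zf2 : L2 (tf_shift z f)) :
  nsq (toL2 zf2) = nsq (toL2 f2).
Proof. by apply: EFin_inj; rewrite !nsq_integral/= tf_shift_integral. Qed.

Lemma tf_shift_bounded z : bounded_operator (tf_shift z : operator R d).
Proof.
split=> [f|a f g f2 g2|]; first exact: tf_shift_L2.
  by apply: aeW => t _; exact: tf_shift_linear.
exists 1 => f f2; have zf2 := tf_shift_L2 z f2.
by rewrite mul1r (normL2E (toL2 zf2)) (normL2E (toL2 f2)) (nsq_tf_shift f2).
Qed.

Local Notation pi_ z := (opfun (tf_shift z)).

Lemma nsq_opfun_tf_shift z u : nsq (pi_ z u) = nsq u.
Proof.
apply: EFin_inj; rewrite !nsq_integral opfunE; last exact: tf_shift_bounded.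
exact: tf_shift_integral (svalP u).
Qed.

(** The extended integral is the difference of the integrals of the positive and negative parts,
    each measurable by Tonelli for any measurable [F]; [fine] then preserves measurability. *)
Lemma measurable_Rintegral2 d1 d2 (X : measurableType d1) (Y : measurableType d2)
    (m : {sigma_finite_measure set Y -> \bar R}) (F : X * Y -> R) :
  measurable_fun setT F -> measurable_fun setT (fun x => \int[m]_y F (x, y)).
Proof.
move=> mF; apply: measurableT_comp; first exact: fine_measurable.
have mEF : measurable_fun setT (EFin \o F) by exact/measurable_EFinP.
rewrite (_ : (fun x => _) = (fun x => \int[m]_y (EFin \o F)^\+ (x, y) -
    \int[m]_y (EFin \o F)^\- (x, y))%E).
  apply: emeasurable_funB; apply: measurable_fun_fubini_tonelli_F => //.
    exact: measurable_funepos.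
  exact: measurable_funeneg.
apply/funext => x; rewrite integralE.
by congr (_ - _)%E; apply: eq_integral => y _; rewrite ?funeposE ?funenegE.
Qed.

Lemma measurable_ip_tf_shift u v :
  measurable_fun setT (fun z => Re (ip (pi_ z u) v)) /\
  measurable_fun setT (fun z => Im (ip (pi_ z u) v)).
Proof.
have [mr mi] := measurable_tf_shift (svalP u).
have [vr vi] := L2_measurable (svalP v).
have vr2 : measurable_fun setT (fun p : (Rd * Rd) * Rd => Re (sval v p.2)).
  exact: (measurableT_comp vr measurable_snd).
have vi2 : measurable_fun setT (fun p : (Rd * Rd) * Rd => Im (sval v p.2)).
  exact: (measurableT_comp vi measurable_snd).
have zE z : ip (pi_ z u) v = inner (tf_shift z (sval u)) (sval v).
  by rewrite -(opfunE u (tf_shift_bounded z)).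
split.
  under eq_fun do rewrite zE /inner /Cintegral ReP.
  apply: (measurable_Rintegral2 mu (F := fun p =>
     Re (tf_shift p.1 (sval u) p.2 * (sval v p.2)^*))).
  under eq_fun do rewrite cReM cReJ cImJ.
  by apply: measurable_funB; apply: measurable_funM => //; exact: measurable_funN.
under eq_fun do rewrite zE /inner /Cintegral ImP.
apply: (measurable_Rintegral2 mu (F := fun p =>
   Im (tf_shift p.1 (sval u) p.2 * (sval v p.2)^*))).
under eq_fun do rewrite cImM cReJ cImJ.
by apply: measurable_funD; apply: measurable_funM => //; exact: measurable_funN.
Qed.

End time_frequency_shifts.

HB.instance Definition _ (T U : ptopologicalType) :=
  Pointed.on (T * U)%type.

(** * Compact subsets of phase space are measurable, of finite measure *)

Section compact_phase_space.
Variables (R : realType) (d : nat).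
Local Notation Rd := 'rV[R]_d.
Implicit Types (c p : Rd * Rd).

Let box (c : Rd) (e : R) : set Rd := [set v | forall i, ball (c ord0 i) e (v ord0 i)].

Lemma measurable_box (c : Rd) (e : R) : measurable (box c e).
Proof.
rewrite (_ : box c e = \bigcap_(i in [set: 'I_d])
    ((fun v : Rd => v ord0 i) @^-1` ball (c ord0 i) e)).
  apply: fin_bigcap_measurable => // i _.
  rewrite -[X in measurable X]setTI.
  exact: (measurable_coord i measurableT (measurable_ball _ _)).
by apply/seteqP; split=> v /= cv i; [move=> _|]; exact: cv.
Qed.

(** Balls of the maximum distance are boxes; this links the topology to the sigma-algebra, which is
    generated by the coordinates. *)
Lemma ball_phaseE c (e : R) : 0 < e -> ball c e = box c.1 e `*` box c.2 e.
Proof.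
move=> e0; apply/seteqP; split=> [p [[_ h1] [_ h2]]|p [h1 h2]].
  by split=> i; [exact: h1|exact: h2].
by split; (split=> // i j; rewrite (ord1 i)); [exact: h1|exact: h2].
Qed.

Lemma measurable_phase_ball c (e : R) : 0 < e -> measurable (ball c e).
Proof. by move=> e0; rewrite ball_phaseE//; apply: measurableX; exact: measurable_box. Qed.

Lemma phase_ball_lty c (e : R) : 0 < e -> (phase_lebesgue R d (ball c e) < +oo)%E.
Proof.
move=> e0; rewrite ball_phaseE//.
have -> : (phase_lebesgue R d (box c.1 e `*` box c.2 e) =
    lebesgue_rV R d (box c.1 e) * lebesgue_rV R d (box c.2 e))%E.
  by apply: product_measure1E; exact: measurable_box.
have box_fin (v : Rd) : (lebesgue_rV R d (box v e) < +oo)%E.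
  rewrite (lebesgue_rV_box (fun i => measurable_ball (v ord0 i) e)).
  under eq_bigr do rewrite lebesgue_measure_ball ?ltW//.
  by rewrite prodEFin ltry.
by rewrite lte_mul_pinfty// ?ge0_fin_numE.
Qed.

Lemma phase_hausdorff : hausdorff_space (Rd * Rd)%type.
Proof.
rewrite ball_hausdorff => a b ab.
have coord_sep (x y : R) : x != y -> exists2 e : {posnum R}, True &
    forall z, ball x e%:num z -> ball y e%:num z -> False.
  move=> xy; have xy0 : 0 < `|x - y| / 2 by rewrite divr_gt0// normr_gt0 subr_eq0.
  exists (PosNum xy0) => // z /=; rewrite -!ball_normE /ball_/= => h1 h2.
  have := ler_distD z x y; rewrite (distrC z y) => h3; lra.
have sep1 (x y : Rd) : x != y -> exists2 e : {posnum R}, True &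
    forall z, ball x e%:num z -> ball y e%:num z -> False.
  move=> xy; have [i xyi] : exists i, x ord0 i != y ord0 i.
    apply: contrapT => /forallNP nex; move/eqP: xy; apply; apply/rowP => i.
    by apply/eqP; apply: contrapT => /negP; exact: nex.
  have [e _ eP] := coord_sep _ _ xyi; exists e => // z [_ h1] [_ h2].
  by apply: (eP (z ord0 i)).
have [ab1|ab1] := eqVneq a.1 b.1; last first.
  have [e _ eP] := sep1 _ _ ab1; exists (e, e); apply/eqP/seteqP; split=> // z.
  by move=> [[h1 _] [h2 _]]; exact: eP h1 h2.
have ab2 : a.2 != b.2.
  by apply: contra ab => /eqP ab2; apply/eqP; case: a b ab1 ab2 => [? ?] [? ?]/= -> ->.
have [e _ eP] := sep1 _ _ ab2; exists (e, e); apply/eqP/seteqP; split=> // z.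
by move=> [[_ h1] [_ h2]]; exact: eP h1 h2.
Qed.

Lemma compact_cover_balls (A : set (Rd * Rd)) (e : R) : compact A -> 0 < e ->
  exists D : set (Rd * Rd)%type, [/\ finite_set D, D `<=` A
    & A `<=` \bigcup_(c in D) ball c e].
Proof.
rewrite compact_cover => Ac e0.
have [c _|p Ap|D DA AD] := Ac (Rd * Rd)%type A (fun c => (ball c e)°).
- exact: open_interior.
- by exists p => //; apply: nbhs_singleton; apply: nbhs_interior; exact: nbhsx_ballx.
exists [set` D]; split=> [|c /DA|p /AD [c Dc /interior_subset cp]].
- exact: finite_fset.
- by rewrite inE.
- by exists c.
Qed.

(** A compact set is the intersection over n of finite unions of balls of radius 1 / (n + 1) centred
    in it: a point of the intersection is a limit of centres, and the set is closed. *)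
Lemma compact_phase_measurable (A : set (Rd * Rd)) : compact A -> measurable A.
Proof.
move=> Ac.
have /choice[D DP] : forall n : nat, exists D : set (Rd * Rd)%type,
    [/\ finite_set D, D `<=` A & A `<=` \bigcup_(c in D) ball c (n.+1%:R^-1 : R)].
  by move=> n; apply: compact_cover_balls => //; rewrite invr_gt0.
rewrite (_ : A = \bigcap_n \bigcup_(c in D n) ball c (n.+1%:R^-1 : R)).
  apply: bigcapT_measurable => n; apply: fin_bigcup_measurable => [|c _]; first by have [] := DP n.
  by apply: measurable_phase_ball; rewrite invr_gt0.
apply/seteqP; split=> [p Ap n _|p Dp]; first by have [_ _] := DP n; exact.
have /closure_id -> : closed A by apply: compact_closed => //; exact: phase_hausdorff.
move=> B /nbhs_ballP[e /= e0 eB].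
have [n ne] : exists n : nat, n.+1%:R^-1 < e.
  by have [n] := ltr_add_invr e0; rewrite add0r => ?; exists n.
have [c Dc cp] := Dp n I.
exists c; split; first by have [_ DA _] := DP n; exact: DA.
by apply: eB; apply: (le_ball (ltW ne)); exact: ball_sym.
Qed.

Lemma compact_phase_lty (A : set (Rd * Rd)) : compact A ->
  (phase_lebesgue R d A < +oo)%E.
Proof.
move=> Ac; have [D [Dfin _ AD]] := compact_cover_balls Ac ltr01.
have h : (phase_lebesgue R d A <= \sum_(c \in D) phase_lebesgue R d (ball c (1 : R)))%E.
  apply: content_sub_fsum => // [c _|]; first exact: measurable_phase_ball.
  exact: compact_phase_measurable.
apply: (le_lt_trans h); rewrite fsbig_finite//= lte_sum_pinfty// => c _.
exact: phase_ball_lty.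
Qed.

End compact_phase_space.

(** * Convolution of a function with an operator *)

Section weighted_integral.
Context dX (X : measurableType dX) (R : realType).
Variables (m : {measure set X -> \bar R}) (p : X -> R).
Hypotheses (p0 : forall x, 0 <= p x) (pint : m.-integrable setT (EFin \o p)).
Implicit Types W : X -> R.

Let abs_le_sqrt W K x : (forall x, W x ^+ 2 <= K) -> `|W x| <= Num.sqrt K.
Proof. by move=> WK; rewrite -sqrtr_sqr ler_wsqrtr. Qed.

Lemma integrable_weighted W K : measurable_fun setT W -> (forall x, W x ^+ 2 <= K) ->
  m.-integrable setT (EFin \o (fun x => p x * W x)).
Proof.
move=> mW WK.
have mp : measurable_fun setT p by apply/measurable_EFinP/measurable_int/pint.
apply: (@le_integrable _ _ _ m setT measurableT _ (fun x => (p x * Num.sqrt K)%:E)).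
- by apply/measurable_EFinP; exact: measurable_funM.
- move=> x _ /=; rewrite lee_fin !normrM ler_wpM2l//.
  by rewrite (ger0_norm (sqrtr_ge0 K)) abs_le_sqrt.
- rewrite (_ : (fun x => _) = (fun x => (Num.sqrt K)%:E * (p x)%:E)%E).
    exact: integrableZl.
  by apply/funext => x; rewrite -EFinM mulrC.
Qed.

Lemma sqr_weighted_le W K : measurable_fun setT W -> (forall x, W x ^+ 2 <= K) ->
  (\int[m]_x (p x * W x)) ^+ 2 <= (\int[m]_x p x) ^+ 2 * K.
Proof.
move=> mW WK; have i1 := integrable_weighted mW WK.
(* The sign of [K] is read off at a point of [X]; if [X] is empty, the integrals vanish. *)
have [x0|noX] := pselect (exists x : X, True); last first.
  have h V : \int[m]_x V x = 0.
    by rewrite /Rintegral integral0_eq// => x; case: noX; exists x.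
  by rewrite !h expr0n/= mul0r.
have K0 : 0 <= K by have [x _] := x0; exact: le_trans (sqr_ge0 _) (WK x).
have p_0 : 0 <= \int[m]_x p x by apply: Rintegral_ge0.
rewrite -[X in _ <= _ * X]sqr_sqrtr// -exprMn -[leLHS]real_normK ?num_real//.
rewrite ler_pXn2r// ?nnegrE ?mulr_ge0 ?sqrtr_ge0//.
rewrite (le_trans (le_normr_Rintegral measurableT i1))//.
rewrite -RintegralZr//; apply: le_Rintegral => //.
- have := integrable_abse i1; congr (integrable _ _ _).
- rewrite (_ : _ \o _ = (fun x => (Num.sqrt K)%:E * (p x)%:E)%E).
    exact: integrableZl.
  by apply/funext => x /=; rewrite -EFinM mulrC.
- move=> x _; rewrite normrM (ger0_norm (p0 x)) ler_wpM2l//; exact: abs_le_sqrt.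
Qed.

End weighted_integral.

Section operator_convolution.
Variables (R : realType) (d : nat) (S : operator R d) (E : nat -> L2hilbert R d).
Local Notation C := R[i].
Local Notation Rd := 'rV[R]_d.
Local Notation H := (L2hilbert R d).
Local Notation Re := complex.Re.
Local Notation Im := complex.Im.
Local Notation sip := (ip_sip H).
Local Notation nsq := (@nsq R H).
Hypotheses (Eo : onb E) (Sb : bounded_operator S) (Sp : positive_operator S).
Implicit Types (g h u v : H) (z : Rd * Rd).
Local Notation pi_ z := (opfun (tf_shift z)).
Local Notation pi_adj z := (opfun (adjoint (tf_shift z))).

Let ip_pi z u v : ip (pi_ z u) v = ip u (pi_adj z v).
Proof. exact: (adjoint_opfun Eo _ _ (tf_shift_bounded z)). Qed.

Let adjb z : bounded_operator (adjoint (tf_shift z : operator R d)).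
Proof. by have [] := adjointP Eo (tf_shift_bounded z). Qed.

(** With w the adjoint applied to v, |w|^4 = |<pi(z) w, v>|^2 <= |w|^2 |v|^2 because pi(z) is an
    isometry. *)
Lemma nsq_pi_adj z v : nsq (pi_adj z v) <= nsq v.
Proof.
set w := pi_adj z v.
have := ip_le (pi_ z w) v; rewrite ip_pi -/w (sip_diag sip) sqnC -/(nsq w).
rewrite nsq_opfun_tf_shift expr2.
have [->|w0] := eqVneq (nsq w) 0; first by rewrite nsq_ge0.
by rewrite ler_pM2l// lt_def w0 nsq_ge0.
Qed.

(** The integrand of the convolution with the outer shift moved to the second argument, where it is
    visibly Hermitian and positive. *)
Definition conv_kernel g h z : C := ip (opfun S (pi_adj z g)) (pi_adj z h).

Lemma conv_kernelE g h z :
  inner (tf_shift z (S (adjoint (tf_shift z) (sval g)))) (sval h) = conv_kernel g h z.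
Proof.
by rewrite /conv_kernel -ip_pi -(opfunE g (adjb z)) -(opfunE _ Sb)
  -(opfunE _ (tf_shift_bounded z)).
Qed.

(** [S] is first moved to the other side, because the adjoint is known to be linear only inside an
    inner product. *)
Lemma conv_kernel_linearl a u v h z :
  conv_kernel (a *: u + v) h z = a * conv_kernel u h z + conv_kernel v h z.
Proof.
have Sps := positive_opfun Sb Sp.
by rewrite /conv_kernel Sps.1 opfun_linear// -!Sps.1.
Qed.

Lemma conv_kernel_conj u v z : conv_kernel v u z = (conv_kernel u v z)^*.
Proof.
have Sps := positive_opfun Sb Sp.
by rewrite /conv_kernel Sps.1 (sip_conj sip).
Qed.

Lemma conv_kernel_ge0 u z : 0 <= Re (conv_kernel u u z) /\ Im (conv_kernel u u z) = 0.
Proof.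
have Sps := positive_opfun Sb Sp; split; first exact: Sps.2.
have := congr1 (@complex.Im R) (conv_kernel_conj u u z); rewrite cImJ; lra.
Qed.

Lemma conv_kernel_bounded : exists2 c : R, 0 <= c &
  forall u v z, sqn (conv_kernel u v z) <= c * (nsq u * nsq v).
Proof.
have [c c0 Sc] := opfun_bounded Sb; exists c => // u v z.
apply: le_trans (ip_le _ _) _; rewrite mulrA.
apply: ler_pM; [exact: nsq_ge0|exact: nsq_ge0| |exact: nsq_pi_adj].
by apply: le_trans (Sc _) _; apply: ler_wpM2l => //; exact: nsq_pi_adj.
Qed.

(** Expanding in the basis and moving the shifts back, the kernel at z is the pointwise limit of the
    sums over k of conj <pi(z) S e_k, u> times <pi(z) e_k, v>, in which the adjoint no longer
    occurs. *)
Lemma measurable_conv_kernel u v :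
  measurable_fun setT (fun z => Re (conv_kernel u v z)) /\
  measurable_fun setT (fun z => Im (conv_kernel u v z)).
Proof.
have Sps := positive_opfun Sb Sp.
pose a n z := \sum_(k < n)
  (ip (pi_ z (opfun S (E k))) u)^* * ip (pi_ z (E k)) v.
have aE n z : a n z = \sum_(k < n) ip (opfun S (pi_adj z u)) (E k) * ip (E k) (pi_adj z v).
  by apply: eq_bigr => k _; rewrite !ip_pi Sps.1 -(sip_conj sip).
have lim z : sqn (a n z - conv_kernel u v z) @[n --> \oo] --> 0.
  under eq_fun do rewrite aE.
  exact: (@parseval_ip _ _ E _ _ Eo).
have mterm k : measurable_fun setT (fun z =>
      Re ((ip (pi_ z (opfun S (E k))) u)^* * ip (pi_ z (E k)) v)) /\
    measurable_fun setT (fun z =>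
      Im ((ip (pi_ z (opfun S (E k))) u)^* * ip (pi_ z (E k)) v)).
  have [mr1 mi1] := measurable_ip_tf_shift (opfun S (E k)) u.
  have [mr2 mi2] := measurable_ip_tf_shift (E k) v.
  split.
    under eq_fun do rewrite cReM cReJ cImJ.
    by apply: measurable_funB; apply: measurable_funM => //; exact: measurable_funN.
  under eq_fun do rewrite cImM cReJ cImJ.
  by apply: measurable_funD; apply: measurable_funM => //; exact: measurable_funN.
have lim0 (x : nat -> R) y z : (forall n, (x n - y) ^+ 2 <= sqn (a n z - conv_kernel u v z)) ->
    x n @[n --> \oo] --> y.
  move=> xy; have h : (x n - y) ^+ 2 @[n --> \oo] --> 0.
    by apply: cvgn0_le (lim z) => n; rewrite sqr_ge0 xy.
  have h2 : `|x n - y| @[n --> \oo] --> 0.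
    under eq_fun do rewrite -sqrtr_sqr.
    by rewrite -sqrtr0; apply: continuous_cvg => //; exact: sqrt_continuous.
  by apply/(@subr_cvg0 _ R^o)/norm_cvg0P.
split.
  apply: (@measurable_fun_cvg _ _ _ setT (fun n z => Re (a n z))).
    by move=> n; under eq_fun do rewrite Re_sum; apply: measurable_sum => k; exact: (mterm k).1.
  move=> z _; apply: (@lim0 _ _ z) => n.
  by rewrite (le_trans _ (Re_sqr_le _))// cReD cReN.
apply: (@measurable_fun_cvg _ _ _ setT (fun n z => Im (a n z))).
  by move=> n; under eq_fun do rewrite Im_sum; apply: measurable_sum => k; exact: (mterm k).2.
move=> z _; apply: (@lim0 _ _ z) => n.
by rewrite (le_trans _ (Im_sqr_le _))// cImD cImN.
Qed.

End operator_convolution.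

(** * Weighted integrals of bounded Hermitian forms *)

Section weighted_forms.
Variables (R : realType) (H : hilbert R) (dX : measure_display).
Variables (X : measurableType dX) (m : {measure set X -> \bar R}).
Variables (p : X -> R) (k : H -> H -> X -> R[i]).
Local Notation Re := complex.Re.
Local Notation Im := complex.Im.
Hypotheses (p0 : forall x, 0 <= p x) (pint : m.-integrable setT (EFin \o p)).
Hypothesis k_linear : forall a u v w x,
  k (a *: u + v) w x = a * k u w x + k v w x.
Hypothesis k_conj : forall u v x, k v u x = (k u v x)^*.
Hypothesis k_bounded : exists2 c : R, 0 <= c &
  forall u v x, sqn (k u v x) <= c * (nsq u * nsq v).
Hypothesis k_measurable : forall u v,
  measurable_fun setT (fun x => Re (k u v x)) /\
  measurable_fun setT (fun x => Im (k u v x)).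
Implicit Types (u v w : H) (F G : X -> R).

Definition weighted_form u v : R[i] :=
  (\int[m]_x (p x * Re (k u v x))) +i* (\int[m]_x (p x * Im (k u v x))).

Lemma weighted_formE u v :
  weighted_form u v = Cintegral m (fun x => (p x)%:C * k u v x).
Proof.
rewrite /weighted_form /Cintegral; congr (_ +i* _); apply: eq_Rintegral => x _;
  by move: (k u v x) => z; rewrite ?cReM ?cImM cReC cImC; ring.
Qed.

Lemma integrable_weighted_kernel u v :
  m.-integrable setT (EFin \o (fun x => p x * Re (k u v x))) /\
  m.-integrable setT (EFin \o (fun x => p x * Im (k u v x))).
Proof.
have [c c0 kc] := k_bounded; have [mr mi] := k_measurable u v; split.
  apply: (integrable_weighted pint mr (K := c * (nsq u * nsq v))) => x.
  exact: le_trans (Re_sqr_le _) (kc _ _ _).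
apply: (integrable_weighted pint mi (K := c * (nsq u * nsq v))) => x.
exact: le_trans (Im_sqr_le _) (kc _ _ _).
Qed.

Let Rintegral_linear (b c : R) F G K :
  m.-integrable setT (EFin \o F) -> m.-integrable setT (EFin \o G) ->
  m.-integrable setT (EFin \o K) ->
  \int[m]_x (b * F x + c * G x + K x) =
    b * \int[m]_x F x + c * \int[m]_x G x + \int[m]_x K x.
Proof.
move=> iF iG iK.
have iZ (r : R) L : m.-integrable setT (EFin \o L) ->
    m.-integrable setT (EFin \o (fun x => r * L x)).
  by move=> iL; exact: (integrableZl measurableT r iL).
rewrite RintegralD//; last first.
  exact: (integrableD measurableT (iZ b _ iF) (iZ c _ iG)).
by rewrite RintegralD//; [rewrite !RintegralZl//|exact: iZ|exact: iZ].
Qed.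

Let complex_linear (a : R[i]) (x1 y1 x2 y2 x3 y3 : R) :
  x1 = Re a * x2 + (- Im a) * y2 + x3 -> y1 = Re a * y2 + Im a * x2 + y3 ->
  x1 +i* y1 = a * (x2 +i* y2) + (x3 +i* y3).
Proof. by case: a => [r i] /= -> ->; apply: complexP => /=; rewrite ?mulNr. Qed.

Lemma weighted_form_linear a u v w :
  weighted_form (a *: u + v) w = a * weighted_form u w + weighted_form v w.
Proof.
have [ur ui] := integrable_weighted_kernel u w.
have [vr vi] := integrable_weighted_kernel v w.
apply: complex_linear; rewrite -Rintegral_linear//; apply: eq_Rintegral => x _;
  by rewrite k_linear ?cReD ?cImD ?cReM ?cImM; ring.
Qed.

Let complex_conj (x1 y1 x2 y2 : R) : x1 = x2 -> y1 = (-1) * y2 ->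
  x1 +i* y1 = (x2 +i* y2)^*.
Proof. by move=> -> ->; apply: complexP => //=; rewrite mulN1r. Qed.

Lemma weighted_form_conj u v : weighted_form v u = (weighted_form u v)^*.
Proof.
have [_ ui] := integrable_weighted_kernel u v.
apply: complex_conj; rewrite -?RintegralZl//; apply: eq_Rintegral => x _;
  by rewrite k_conj ?cReJ ?cImJ//; ring.
Qed.

Lemma weighted_form_bounded : exists2 c : R, 0 <= c &
  forall u v, sqn (weighted_form u v) <= c * (nsq u * nsq v).
Proof.
have [c c0 kc] := k_bounded.
(* The factor 2 adds the equal bounds for the real and the imaginary part. *)
set V := \int[m]_x p x; exists (2 * (V ^+ 2 * c)).
  by apply: mulr_ge0 => //; apply: mulr_ge0 => //; exact: sqr_ge0.
move=> u v; have [mr mi] := k_measurable u v.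
have hr : (\int[m]_x (p x * Re (k u v x))) ^+ 2 <= V ^+ 2 * (c * (nsq u * nsq v)).
  apply: (sqr_weighted_le p0 pint mr) => x.
  exact: le_trans (Re_sqr_le _) (kc _ _ _).
have hi : (\int[m]_x (p x * Im (k u v x))) ^+ 2 <= V ^+ 2 * (c * (nsq u * nsq v)).
  apply: (sqr_weighted_le p0 pint mi) => x.
  exact: le_trans (Im_sqr_le _) (kc _ _ _).
rewrite (_ : 2 * _ * _ = V ^+ 2 * (c * (nsq u * nsq v)) + V ^+ 2 * (c * (nsq u * nsq v))).
  exact: lerD hr hi.
by ring.
Qed.

End weighted_forms.

Lemma weighted_form_scale (R : realType) (H : hilbert R) dX (X : measurableType dX)
    (m : {measure set X -> \bar R}) (p : X -> R) (k : H -> H -> X -> R[i])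
    (a : R) (u v : H) :
  m.-integrable setT (EFin \o (fun x => p x * complex.Re (k u v x))) ->
  m.-integrable setT (EFin \o (fun x => p x * complex.Im (k u v x))) ->
  weighted_form m (fun x => a * p x) k u v = a%:C * weighted_form m p k u v.
Proof.
move=> ir ii; have aC (x y : R) : a%:C * (x +i* y) = (a * x) +i* (a * y).
  by apply: complexP => /=; ring.
rewrite aC -!RintegralZl//; congr (_ +i* _); apply: eq_Rintegral => x _;
  by rewrite mulrA.
Qed.

(** * Existence, positivity and trace of the convolution *)

Section operator_convolution_trace.
Variables (R : realType) (d : nat) (S : operator R d) (E : nat -> L2hilbert R d).
Local Notation C := R[i].
Local Notation Rd := 'rV[R]_d.
Local Notation H := (L2hilbert R d).
Local Notation Re := complex.Re.
Local Notation Im := complex.Im.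
Local Notation sip := (ip_sip H).
Local Notation nsq := (@nsq R H).
Hypotheses (Eo : onb E) (Sb : bounded_operator S) (Sp : positive_operator S).
Variable p : Rd * Rd -> R.
Local Notation ph := (phase_lebesgue R d).
Hypotheses (p0 : forall z, 0 <= p z) (pint : ph.-integrable setT (EFin \o p)).
Implicit Types (g h u v : H) (z : Rd * Rd).
Local Notation ker := (conv_kernel S).
Local Notation pi_ z := (opfun (tf_shift z)).
Local Notation pi_adj z := (opfun (adjoint (tf_shift z))).

Definition conv_form := weighted_form ph p ker.

Lemma conv_formE u v :
  conv_form u v = Cintegral ph (fun z => (p z)%:C *
    inner (tf_shift z (S (adjoint (tf_shift z) (sval u)))) (sval v)).
Proof.
rewrite /conv_form weighted_formE; congr Cintegral; apply/funext => z.
by rewrite (conv_kernelE Eo Sb).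
Qed.

Let kernel_linear := conv_kernel_linearl Eo Sb Sp.
Let kernel_conj := conv_kernel_conj Sb Sp.
Let kernel_bounded := conv_kernel_bounded Eo Sb.
Let kernel_measurable := measurable_conv_kernel Eo Sb Sp.

Let integrable_ker u v := (integrable_weighted_kernel pint kernel_bounded
  kernel_measurable u v).

Let T := op_conv (fun z => (p z)%:C) S.

(** The weighted form of the kernel is bounded and Hermitian, so some operator realizes it; only
    then is the choice in [op_conv] meaningful. *)
Lemma op_convP : is_op_conv (fun z => (p z)%:C) S T.
Proof.
have [c c0 bc] := weighted_form_bounded p0 pint kernel_bounded kernel_measurable.
have lin := weighted_form_linear pint kernel_linear kernel_bounded kernel_measurable.
have cj := weighted_form_conj pint kernel_conj kernel_bounded kernel_measurable.
have [K [KP Kb]] := hermitian_operator Eo c0 lin cj bc.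
apply: xgetPex; exists (ofun K); split=> // g h g2 h2.
rewrite (ofunE K g2) -[LHS]/(ip (K (toL2 g2)) (toL2 h2)) KP.
exact: conv_formE.
Qed.

Lemma op_conv_bounded : bounded_operator T.
Proof. by have [] := op_convP. Qed.

Lemma ip_op_conv u v : ip (opfun T u) v = conv_form u v.
Proof.
have [Tb TP] := op_convP; rewrite conv_formE -(TP _ _ (svalP u) (svalP v)).
by rewrite -(opfunE u Tb).
Qed.

Lemma quad_op_conv u : quad (opfun T) u = \int[ph]_z (p z * Re (ker u u z)).
Proof. by rewrite /quad ip_op_conv. Qed.

Lemma op_conv_positive : positive_symmetric (opfun T).
Proof.
split=> [u v|u].
  rewrite [RHS](sip_conj sip) !ip_op_conv.
  exact: (weighted_form_conj pint kernel_conj kernel_bounded kernel_measurable v u).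
rewrite quad_op_conv; apply: Rintegral_ge0 => z _.
by rewrite mulr_ge0//; have [] := conv_kernel_ge0 Sb Sp u z.
Qed.

Hypothesis Str : \sum_(i < n) quad (opfun S) (E i) @[n --> \oo] --> (1 : R).

Lemma quad_rotated_sum z :
  \sum_(k < n) quad (opfun S) (pi_adj z (E k)) @[n --> \oo] --> (1 : R).
Proof.
have Sps := positive_opfun Sb Sp.
have q0 (f : nat -> H) k : 0 <= quad (opfun S) (f k) := Sps.2 _.
have St : trace_form E (opfun S).
  split=> //.
    exact: opfun_bounded_form.
  exists 1 => n; rewrite -(cvg_lim _ Str)//; apply: nondecreasing_cvgn_le.
    exact: nondecreasing_psum (q0 E).
  by apply/cvg_ex; exists 1.
have [s [phi Ssp]] := eigen_decomposition_exists Eo St.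
have rotated u : \sum_(k < n) sqn (ip u (pi_adj z (E k))) @[n --> \oo] --> nsq u.
  rewrite -(nsq_opfun_tf_shift z u).
  have -> : (fun n => \sum_(k < n) sqn (ip u (pi_adj z (E k)))) =
      (fun n => \sum_(k < n) sqn (ip (pi_ z u) (E k))).
    apply/funext => n; apply: eq_bigr => k _.
    by rewrite (adjoint_opfun Eo _ _ (tf_shift_bounded z)).
  exact: parseval.
have e1 := trace_spectral Ssp (f := fun k => pi_adj z (E k)) rotated.
have e2 := trace_spectral Ssp (f := E) (fun u => @parseval _ _ E u Eo).
have e3 := nneseries_psum (q0 E) Str.
by apply: (psum_nneseries (q0 (fun k => pi_adj z (E k)))); rewrite e1 -e2.
Qed.

Lemma op_conv_trace :
  \sum_(k < n) quad (opfun T) (E k) @[n --> \oo] --> \int[ph]_z p z.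
Proof.
apply: (@psum_nneseries _ (fun k => quad (opfun T) (E k))) => [n|].
  exact: op_conv_positive.2.
have kge0 k z : 0 <= Re (ker (E k) (E k) z) by have [] := conv_kernel_ge0 Sb Sp (E k) z.
transitivity (\sum_(0 <= k <oo) \int[ph]_z (p z * Re (ker (E k) (E k) z))%:E)%E.
  apply: eq_eseriesr => k _; rewrite quad_op_conv /Rintegral fineK//.
  have [ik _] := integrable_ker (E k) (E k).
  exact: (integrable_fin_num measurableT ik).
rewrite -integral_nneseries//; last 2 first.
- move=> k; have [ik _] := integrable_ker (E k) (E k).
  exact: (measurable_int _ ik).
- by move=> k z _; rewrite lee_fin mulr_ge0.
rewrite /Rintegral fineK; last exact: (integrable_fin_num measurableT pint).
apply: eq_integral => z _.
apply: (@nneseries_psum _ (fun k => p z * Re (ker (E k) (E k) z))) => [k|].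
  by rewrite mulr_ge0.
rewrite -[X in _ --> X]mulr1; under eq_fun do rewrite -mulr_sumr.
by apply: cvgM; [exact: cvg_cst|exact: quad_rotated_sum].
Qed.

End operator_convolution_trace.

(** Relates the operator inside the projection functional to the normalized one inside the entropy,
    two independent choices of [op_conv]. *)
Lemma ip_op_conv_scale (R : realType) (d : nat) (S : operator R d)
    (E : nat -> L2hilbert R d) (p : 'rV[R]_d * 'rV[R]_d -> R) (a : R)
    (u v : L2hilbert R d) :
  onb E -> bounded_operator S -> positive_operator S -> (forall z, 0 <= p z) ->
  (phase_lebesgue R d).-integrable setT (EFin \o p) -> 0 <= a ->
  ip (opfun (op_conv (fun z => (a * p z)%:C) S) u) v =
  a%:C * ip (opfun (op_conv (fun z => (p z)%:C) S) u) v.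
Proof.
move=> Eo Sb Sp p0 pint a0.
have [ir ii] := integrable_weighted_kernel pint (conv_kernel_bounded Eo Sb)
  (measurable_conv_kernel Eo Sb Sp) u v.
apply: etrans (ip_op_conv Eo Sb Sp (fun z => mulr_ge0 a0 (p0 z))
  (integrableZl measurableT a pint) u v) _.
apply: etrans _ (congr1 _ (esym (ip_op_conv Eo Sb Sp p0 pint u v))).
exact: weighted_form_scale.
Qed.

(** * Entropy *)

Section entropy_lower_bound.
Variables (R : realType) (d : nat) (T : operator R d).
Local Notation C := R[i].
Local Notation H := (L2hilbert R d).
Local Notation sip := (ip_sip H).
Local Notation nsq := (@nsq R H).
Variables (s : nat -> R) (phi : nat -> H).
Hypotheses (Tb : bounded_operator T) (Tsp : eigen_decomposition (opfun T) s phi).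

Lemma sval_sum n (F : 'I_n -> H) t : sval (\sum_(i < n) F i) t = \sum_(i < n) sval (F i) t.
Proof.
elim: n F => [|n IH] F; first by rewrite !big_ord0.
rewrite !big_ord_recl -IH -[F ord0]scale1r.
by rewrite [LHS]sval_linear mul1r scale1r.
Qed.

Lemma sval_scale a (u : H) t : sval (a *: u) t = a * sval u t.
Proof. by rewrite -[a *: u]addr0 [LHS]sval_linear addr0. Qed.

(** The [phi i] with [s i = l] are orthonormal eigenvectors: as [l] is not 0, none of them is
    padding. *)
Lemma multiplicity_ge N (l : R) : l != 0 ->
  (#|[pred i : 'I_N | s i == l]|%:R%:E <= multiplicity T l)%E.
Proof.
move=> l0; set J := [pred i : 'I_N | s i == l].
apply: ereal_sup_ubound; exists #|J| => //.
pose w (i : 'I_#|J|) := phi (enum_val i : 'I_N).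
have sw (i : 'I_#|J|) : s (enum_val i : 'I_N) = l.
  have /= h : enum_val i \in J := enum_valP i.
  exact/eqP.
exists (fun i => sval (w i)) => [i|c c0 j].
  split; first exact: svalP.
  rewrite -(opfunE (w i) Tb) (_ : (fun t => _) = sval (l%:C *: w i : H)); last first.
    by apply/funext => t; rewrite [RHS]sval_scale.
  apply/eqL2_nsq/nsq0_ip => x.
  by rewrite (eigdec_eigen Tsp) sw (sipZl sip).
(* If the combination vanishes almost everywhere it is a null vector, and pairing it with [w j]
   isolates [c j]. *)
pose x : H := \sum_i c i *: w i.
have x0 : nsq x = 0.
  rewrite -[x]subr0; apply/eqL2_nsq; rewrite (_ : sval x = fun t => \sum_i c i * sval (w i) t)//.
  apply/funext => t; rewrite [LHS]sval_sum; apply: eq_bigr => i _; exact: sval_scale.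
have := sip_null sip (w j) x0; rewrite (sip_suml sip) (bigD1 j)// big1 => [|i ij].
  rewrite Monoid.mulm1 (sipZl sip) (sip_diag sip) -/(nsq _).
  have [[_ ->]|[h _]] := eigdec_unit Tsp (enum_val j : 'I_N); first by rewrite mulr1.
  by rewrite -(sw j) h eqxx in l0.
rewrite (sipZl sip) (eigdec_ortho Tsp) ?mulr0// => /val_inj/enum_val_inj.
by move/eqP; rewrite (negPf ij).
Qed.

(** Group the first [N] indices by eigenvalue and compare with a finite subsum of the entropy. The
    bound [s i <= 1] makes -l ln l nonnegative, so that it may multiply the lower bounds on
    multiplicities. *)
Lemma vN_entropy_ge N : (forall i, s i <= 1) ->
  ((\sum_(i < N) - (s i * ln (s i)))%:E <= vN_entropy T)%E.
Proof.
move=> s1; pose F l : R := - (l * ln l).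
have s0 := eigdec_ge0 Tsp.
(* The value 0 is left out: padding gives no eigenvectors, and its term vanishes. *)
pose L := [seq l <- undup [seq s (i : 'I_N) | i : 'I_N] | l != 0].
have LN0 l : l \in L -> l != 0 by rewrite mem_filter => /andP[].
have F0 l : l \in L -> 0 <= F l.
  rewrite mem_filter mem_undup => /andP[l0 /mapP[i _ li]].
  by rewrite /F li oppr_ge0; apply: mulr_ge0_le0 => //; exact: ln_le0.
apply: (@le_trans _ _ (\sum_(l <- L) multiplicity T l * (F l)%:E)%E); last first.
  apply: ereal_sup_ubound; exists [set` L]; first by split; [exact: finite_seq|].
  by rewrite -fsbig_seq// filter_uniq// undup_uniq.
have -> : \sum_(i < N) - (s i * ln (s i)) =
    \sum_(l <- L) F l *+ #|[pred i : 'I_N | s i == l]|.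
  transitivity (\sum_(i < N | s i != 0) F (s i)).
    rewrite [LHS](bigID (fun i : 'I_N => s i != 0))/= [X in _ + X]big1 ?addr0//.
    by move=> i; rewrite negbK => /eqP ->; rewrite mul0r oppr0.
  transitivity (\sum_(i < N | s i != 0) \sum_(l <- L | l == s i) F l).
    apply: eq_bigr => i si; rewrite -big_filter (@filter_pred1_uniq _ L) ?big_seq1//.
      by rewrite filter_uniq// undup_uniq.
    by rewrite mem_filter si mem_undup; apply: map_f; rewrite mem_enum.
  rewrite (exchange_big_dep xpredT)//= big_seq [RHS]big_seq; apply: eq_bigr => l lL.
  rewrite -sumr_const; apply: eq_bigl => i; rewrite inE (eq_sym l).
  by case: (eqVneq (s i) l) => [->|_]; rewrite ?andbT ?andbF//; exact: LN0.
rewrite -sumEFin big_seq [leRHS]big_seq; apply: lee_sum => l lL.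
rewrite -mulr_natl EFinM; apply: lee_wpmul2r; first by rewrite lee_fin F0.
exact/multiplicity_ge/LN0.
Qed.

End entropy_lower_bound.

Theorem lemma3p5 (R : realType) (d : nat) (d_gt0 : (0 < d)%N)
    (Omega : set ('rV[R]_d * 'rV[R]_d)) (S : operator R d)
    (Omega_compact : compact Omega)
    (Omega_gt0 : (0 < phase_lebesgue R d Omega)%E)
    (S_trace_class : trace_class S) (S_positive : positive_operator S)
    (S_trace : trace S = 1) :
  let vol : R := fine (phase_lebesgue R d Omega) in
  ((ln vol
    + vol^-1 * projection_functional
        (op_conv (fun z => (\1_Omega z)%:C) S))%:E
  <= vN_entropy (op_conv (fun z => (\1_Omega z / vol)%:C) S))%E.
Proof.
cbv zeta; set vol : R := fine (phase_lebesgue R d Omega).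
have mO := compact_phase_measurable Omega_compact.
have O_lty := compact_phase_lty Omega_compact.
have vol0 : 0 < vol by rewrite fine_gt0// Omega_gt0.
have volE : (phase_lebesgue R d Omega) = vol%:E by rewrite fineK// ge0_fin_numE.
have [Sb [A [e [_ eb _]]]] := S_trace_class.
have sb : orthonormal_basis (@std_basis R d) by apply: xgetPex; exists e.
have [E [Eo Ee]] := onb_orthonormal_basis sb.
have trE (T : operator R d) n : bounded_operator T ->
    inner (T (@std_basis R d n)) (@std_basis R d n) = ip (opfun T (E n)) (E n).
  by move=> Tb; rewrite -Ee -(opfunE (E n) Tb).
have Sps := positive_opfun Sb S_positive.
have Str : \sum_(i < n) quad (opfun S) (E i) @[n --> \oo] --> (1 : R).
  have : limn (series (fun n => complex.Re
     (inner (S (@std_basis R d n)) (@std_basis R d n)))) = 1.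
    exact: (congr1 (@complex.Re R) S_trace).
  have -> : series (fun n => complex.Re
       (inner (S (@std_basis R d n)) (@std_basis R d n))) =
     (fun n => \sum_(i < n) quad (opfun S) (E i)).
    rewrite seriesEord; apply/funext => n; apply: eq_bigr => i _.
    by rewrite trE.
  set u := (fun n => _) => u1.
  (* A divergent sequence has the default limit 0, so the limit 1 proves convergence. *)
  have : cvgn u by apply: contrapT => /dvgP; rewrite u1 => /eqP; rewrite oner_eq0.
  by move/cvg_ex => [l ul]; rewrite -u1 (cvg_lim _ ul).
pose w z : R := \1_Omega z.
have indint : (phase_lebesgue R d).-integrable setT (fun z => (w z)%:E).
  apply/integrableP; split; first exact/measurable_EFinP/measurable_indic.
  rewrite (eq_integral (fun z => (w z)%:E)); last first.
    by move=> t _; rewrite gee0_abs// lee_fin.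
  by rewrite integral_indic// setIT.
have wint (a : R) : (phase_lebesgue R d).-integrable setT (EFin \o (fun z => w z * a)).
  rewrite (_ : _ \o _ = (fun z => a%:E * (w z)%:E)%E).
    exact: integrableZl.
  by apply/funext => z /=; rewrite -EFinM mulrC.
have w0 (a : R) : 0 <= a -> forall z, 0 <= w z * a by move=> a0 z; rewrite mulr_ge0.
have wI (a : R) : \int[phase_lebesgue R d]_z (w z * a) = vol * a.
  rewrite (RintegralZr a measurableT indint).
  by rewrite /Rintegral integral_indic// setIT volE.
set T1 := op_conv _ S; set T2 := op_conv _ S.
have v0 : 0 <= vol^-1 by rewrite invr_ge0 ltW.
pose p2 z := w z * vol^-1; have p20 : forall z, 0 <= p2 z := w0 _ v0.
have p2int : (phase_lebesgue R d).-integrable setT (EFin \o p2) := wint vol^-1.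
have p1E z : vol * p2 z = w z by rewrite /p2 mulrCA mulfV ?mulr1// gt_eqF.
have p10 z : 0 <= w z by [].
have T1b : bounded_operator T1 := op_conv_bounded Eo Sb S_positive p10 indint.
have T2b : bounded_operator T2 := op_conv_bounded Eo Sb S_positive p20 p2int.
have T1ps : positive_symmetric (opfun T1).
  exact: (op_conv_positive Eo Sb S_positive p10 indint).
have T2ps : positive_symmetric (opfun T2).
  exact: (op_conv_positive Eo Sb S_positive p20 p2int).
have T1tr : \sum_(k < n) quad (opfun T1) (E k) @[n --> \oo] --> vol.
  have -> : vol = \int[phase_lebesgue R d]_z w z.
    by rewrite -[LHS]mulr1 -wI; apply: eq_Rintegral => z _; rewrite mulr1.
  exact: (op_conv_trace Eo Sb S_positive p10 indint Str).
have T2tr : \sum_(k < n) quad (opfun T2) (E k) @[n --> \oo] --> (1 : R).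
  have := op_conv_trace Eo Sb S_positive p20 p2int Str.
  by rewrite wI mulfV ?gt_eqF.
have T12 u v : ip (opfun T1 u) v = vol%:C * ip (opfun T2 u) v.
  rewrite -(ip_op_conv_scale u v Eo Sb S_positive p20 p2int (ltW vol0)).
  congr (ip (opfun (op_conv _ S) u) v); apply/funext => z.
  by rewrite p1E.
have nsq12 u : nsq (opfun T1 u) = vol ^+ 2 * nsq (opfun T2 u).
  exact: nsq_scaled (T12 u).
have [c T2c] := opfun_bounded_form T2b.
have T2sum n : \sum_(k < n) quad (opfun T2) (E k) <= 1.
  rewrite -(cvg_lim _ T2tr)//; apply: nondecreasing_cvgn_le.
    exact: (@nondecreasing_psum _ (fun k => quad (opfun T2) (E k)) (fun k => T2ps.2 _)).
  by apply/cvg_ex; exists 1.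
have c0 : 0 <= c.
  have := T2c (E 0%N); rewrite (onb_nsq _ Eo) mulr1; apply: le_trans; exact: T2ps.2.
(* [t] is the trace of the square of [T2]; it is finite since |T2 e_k|^2 <= c <T2 e_k, e_k> and [T2]
   has trace 1. *)
have [t tl tle] : exists2 t, \sum_(k < n) nsq (opfun T2 (E k)) @[n --> \oo] --> t &
    forall n, \sum_(k < n) nsq (opfun T2 (E k)) <= t.
  apply: (@nondecreasing_cvgn_bounded _ _ c).
    exact: (@nondecreasing_psum _ (fun k => nsq (opfun T2 (E k))) (fun k => nsq_ge0 _)).
  move=> n; apply: (@le_trans _ _ (\sum_(k < n) c * quad (opfun T2) (E k))).
    by apply: ler_sum => k _; exact: nsq_le_quad.
  by rewrite -mulr_sumr ler_piMr.
have trace_eq (T : operator R d) (q : nat -> R) (l : R) :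
    (forall n, complex.Re (inner (T (@std_basis R d n)) (@std_basis R d n)) = q n) ->
    \sum_(k < n) q k @[n --> \oo] --> l -> complex.Re (trace T) = l.
  move=> Tq ql; rewrite /trace ReP; apply/cvg_lim => //.
  by rewrite (_ : (fun n => _) = q) ?seriesEord//; exact/funext.
have trT1 : complex.Re (trace T1) = vol.
  by apply: trace_eq T1tr => n; rewrite trE.
have trT1T1 : complex.Re (trace (T1 \o T1)) = vol ^+ 2 * t.
  apply: (@trace_eq _ (fun n => vol ^+ 2 * nsq (opfun T2 (E n)))) => [n|].
    rewrite -nsq12 /nsq -T1ps.1 -Ee.
    rewrite -[ip _ _]/(inner (sval (opfun T1 (opfun T1 (E n)))) (sval (E n))).
    by rewrite (opfunE (opfun T1 (E n)) T1b) (opfunE (E n) T1b).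
  under eq_fun do rewrite -mulr_sumr.
  by apply: cvgM => //; exact: cvg_cst.
(* [T1] acts as [vol] times [T2], hence the square of [vol] in the second trace. *)
have -> : projection_functional T1 = vol - vol ^+ 2 * t.
  have ReB (x y : R[i]) : complex.Re (x - y) = complex.Re x - complex.Re y.
    by rewrite cReD cReN.
  transitivity (complex.Re (trace T1) - complex.Re (trace (T1 \o T1))).
    exact: ReB.
  by congr (_ - _).
have T2t : trace_form E (opfun T2).
  by split=> //; [exact: opfun_bounded_form|exists 1].
have [s [phi sp]] := eigen_decomposition_exists Eo T2t.
have s0 := eigdec_ge0 sp.
have s1 : \sum_(i < n) s i @[n --> \oo] --> (1 : R).
  apply: (psum_nneseries s0).
  rewrite -(trace_spectral sp (f := E) (fun u => @parseval _ _ E u Eo)).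
  by apply: nneseries_psum => // k; exact: T2ps.2.
have sle n : \sum_(i < n) s i <= 1.
  rewrite -(cvg_lim _ s1)//; apply: nondecreasing_cvgn_le.
    exact: (nondecreasing_psum s0).
  by apply/cvg_ex; exists 1.
have si1 i : s i <= 1.
  apply: le_trans (sle i.+1); rewrite big_ord_recr/= lerDr.
  exact: sumr_ge0.
(* The left-hand side takes the form of the bound in [entropy_ge] with [c = vol]. *)
have -> : ln vol + vol^-1 * (vol - vol ^+ 2 * t) = ln vol + 1 - vol * t.
  by field; rewrite gt_eqF.
apply: (entropy_ge vol0 s0 s1) => [n|n]; first exact: (sum_sqr_spectral T2ps sp n Eo tle).
exact: (vN_entropy_ge T2b sp n si1).
Qed.
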